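(* Let $k\in\{1,2\}$ and let $\Phi_{k,\gamma}$ be used as the reduced basis for the Lagrange multiplier. Then, for any mesh size and any dimensions of the composite reduced bases, the Schur complement $$ \widetilde S=\widetilde G_1\widetilde M_1^{-1}\widetilde G_1^T+\widetilde G_2\widetilde M_2^{-1}\widetilde G_2^T $$ of the composite reduced basis coupled ROM-ROM problem is symmetric and positive definite (in particular, non-singular).
   Context: Setting. $\Omega\subset\mathbb{R}^\nu$, $\nu\in\{2,3\}$, is a bounded region divided by an interface $\gamma$ into two non-overlapping subdomains $\Omega_1,\Omega_2$; $\Gamma_i=\partial\Omega_i\setminus\gamma$. For $i=1,2$, $\Omega_i^h$ is a quasi-uniform finite element partition of $\Omega_i$; the two subdomains are meshed independently. The partitions $\gamma^h_1,\gamma^h_2$ of $\gamma$ induced by them are spatially coincident but their vertices need not match. Finite element spaces. $S^h_i\subset H^1(\Omega_i)$ is the lowest-order nodal $C^0$ finite element space on $\Omega^h_i$ with nodal Lagrange basis $\{N_{i,r}\}$. Nodes are classified as Dirichlet nodes (on $\Gamma_i$, including nodes on both $\Gamma_i$ and $\gamma$), interface nodes (the remaining nodes on $\gamma$; there are $n_{i,\gamma}$ of them), and interior nodes ($n_{i,0}$ of them). $S^h_{i,\gamma}$ is the span of the nodal basis functions of the interface nodes, and $G^h_i=S^h_{i,\gamma}|_\gamma$ is its trace space on $\gamma$, with basis given by the traces of those nodal basis functions. Matrices. For $p,q\in\{\gamma,0\}$, $M_{i,pq}\in\mathbb{R}^{n_{i,p}\times n_{i,q}}$ is the block of the $L^2(\Omega_i)$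 mass matrix (entries $\int_{\Omega_i}N_{i,r}N_{i,s}\,dx$) with rows indexed by interface ($p=\gamma$) or interior ($p=0$) nodes and columns likewise by $q$. $G_{i,\gamma}\in\mathbb{R}^{n_{k,\gamma}\times n_{i,\gamma}}$ has entries $\int_\gamma N_{k,r}N_{i,s}\,ds$, with $r$ ranging over the interface nodes of $\Omega^h_k$ and $s$ over the interface nodes of $\Omega^h_i$ (the Lagrange multiplier space is $G^h_k$). Reduced bases. For $i=1,2$ and $p\in\{\gamma,0\}$, $\Phi_{i,p}\in\mathbb{R}^{n_{i,p}\times d_{i,p}}$, $0<d_{i,p}\le n_{i,p}$, is a POD reduced basis matrix: its columns are the first $d_{i,p}$ left singular vectors (hence orthonormal) of a snapshot matrix with $n_{i,p}$ rows. The interface and interior bases are computed independently, and the pair $\{\Phi_{i,\gamma},\Phi_{i,0}\}$ is called the composite reduced basis on $\Omega_i$. Coupled ROM-ROM problem. Its matrix is formed from the projected blocks $\widetilde M_{i,pq}=\Phi_{i,p}^TM_{i,pq}\Phi_{i,q}$ and $\widetilde G_{i,\gamma}=\Phi_{k,\gamma}^TG_{i,\gamma}\Phi_{i,\gamma}$: $$ \widetilde M_i=\begin{bmatrix}\widetilde M_{i,\gamma\gamma}&\widetilde M_{i,\gamma0}\\ \widetilde M_{i,0\gamma}&\widetilde M_{i,00}\end{bmatrix},\qquad \widetilde G_i=\begin{bmatrix}\widetilde G_{i,\gamma}&0\end{bmatrix},\qquad \begin{bmatrix}\widetilde M_1&0&\widetilde G_1^T\\0&\widetilde M_2&-\widetilde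 G_2^T\\ \widetilde G_1&-\widetilde G_2&0\end{bmatrix}, $$ where the zero block of $\widetilde G_i$ has size $d_{k,\gamma}\times d_{i,0}$. *)

(* Defs.v *)
From HB Require Import structures.
From mathcomp Require Import all_boot all_order all_algebra.
From mathcomp Require Import all_classical all_reals all_analysis.

Set Implicit Arguments.
Unset Strict Implicit.
Unset Printing Implicit Defensive.

Import Order.TTheory GRing.Theory Num.Theory.
Import numFieldNormedType.Exports.

Local Open Scope classical_set_scope.
Local Open Scope ring_scope.

(* The canonical norm of 'rV[R]_nu is the sup norm: it gives the right topology
   but the wrong lengths and areas, hence the explicit Euclidean norm. *)
Definition enorm (R : realType) (nu : nat) (x : 'rV[R]_nu) : R :=
  Num.sqrt (\sum_(j < nu) x ord0 j ^+ 2).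

Definition boundary (T : topologicalType) (A : set T) : set T :=
  closure A `\` A°.

Section CoverOuter.
Context {R : realType} {T : pointedType}.
Local Open Scope ereal_scope.
Implicit Type tau : set T -> \bar R.

(* The empty set is given weight 0 whatever tau says about it. *)
Definition weight0 tau (U : set T) : \bar R :=
  if `[< U = set0 >] then 0 else tau U.

Definition cover_outer tau (A : set T) : \bar R :=
  ereal_inf [set \sum_(k <oo) weight0 tau (U k) |
             U in [set U : (set T)^nat | A `<=` \bigcup_k U k]].

(* T with every set measurable, which turns cover_outer into the library's
   mu_ext. *)
Let P := g_sigma_algebraType (@setT (set T)).

Let cover_outerE tau : cover_outer tau = @mu_ext _ P R (weight0 tau).
Proof.
apply/funext => A; congr ereal_inf; apply/seteqP; split => _ [U AU <-].
  by exists U => //; split => // i; exact: sub_gen_smallest.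
by exists U => //; case: AU.
Qed.

Let weight00 tau : weight0 tau set0 = 0.
Proof. by rewrite /weight0; case: asboolP. Qed.

Section Nonneg.
Variable tau : set T -> \bar R.
Hypothesis tau_ge0 : forall U, 0 <= tau U.

Let weight_ge0 (U : set P) : 0 <= weight0 tau U.
Proof. by rewrite /weight0; case: asboolP. Qed.

Lemma cover_outer0 : cover_outer tau set0 = 0.
Proof. by rewrite cover_outerE mu_ext0. Qed.

Lemma cover_outer_ge0 A : 0 <= cover_outer tau A.
Proof. by rewrite cover_outerE mu_ext_ge0. Qed.

Lemma cover_outer_le : {homo cover_outer tau : A B / A `<=` B >-> A <= B}.
Proof.
move=> A B AB; apply/ereal_inf_le_tmp => _ [U BU <-].
by exists U => //; exact: subset_trans BU.
Qed.

Lemma cover_outer_sigma_subadditive : sigma_subadditive (cover_outer tau).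
Proof.
rewrite cover_outerE.
have := @mu_ext_sigma_subadditive _ P R _ weight_ge0.
exact.
Qed.

End Nonneg.
End CoverOuter.

Definition caratheodory_measure (R : realType) (T : pointedType)
    (mu : {outer_measure set T -> \bar R}) :
    {measure set (caratheodory_type mu) -> \bar R} :=
  (mu : set (caratheodory_type mu) -> \bar R).

Section Lebesgue.
Context (R : realType) (nu : nat).
Local Open Scope ereal_scope.

(* Volume of the smallest closed box containing U. *)
Definition box_volume (U : set 'rV[R]_nu) : \bar R :=
  ereal_inf [set (\prod_(j < nu) (ab.2 ord0 j - ab.1 ord0 j)%R)%:E |
    ab in [set ab : 'rV[R]_nu * 'rV[R]_nu |
      (forall j, (ab.1 ord0 j <= ab.2 ord0 j)%R) /\
      U `<=` [set x | forall j, (ab.1 ord0 j <= x ord0 j <= ab.2 ord0 j)%R]]].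

Lemma box_volume_ge0 U : 0 <= box_volume U.
Proof.
apply: le_ereal_inf_tmp => _ [[a b] [/= ab _] <-].
by rewrite lee_fin prodr_ge0// => j _; rewrite subr_ge0.
Qed.

Definition lebesgue_outer : set 'rV[R]_nu -> \bar R := cover_outer box_volume.

HB.instance Definition _ := isOuterMeasure.Build R 'rV[R]_nu lebesgue_outer
  (cover_outer0 box_volume_ge0) (cover_outer_ge0 box_volume_ge0)
  (@cover_outer_le _ _ box_volume)
  (cover_outer_sigma_subadditive box_volume_ge0).

Definition lebesgue_rV := caratheodory_measure lebesgue_outer.

End Lebesgue.

(* Volume of the unit ball of R^s. *)
Fixpoint ball_volume (R : realType) (s : nat) : R :=
  match s with
  | 0 => 1
  | 1 => 2
  | s'.+2 => 2 * pi / s'.+2%:R * ball_volume R s'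
  end.

Section Hausdorff.
Context (R : realType) (nu s : nat).
Local Open Scope ereal_scope.

Definition diam (U : set 'rV[R]_nu) : \bar R :=
  ereal_sup [set (enorm (xy.1 - xy.2))%:E | xy in U `*` U].

(* s-dimensional weight of a set of diameter at most delta; larger sets (and the
   empty set, which weight0 takes care of) are not to be used in coverings. *)
Definition hausdorff_weight (delta : R) (U : set 'rV[R]_nu) : \bar R :=
  if `[< U !=set0 /\ diam U <= delta%:E >]
  then (ball_volume R s / 2 ^+ s)%:E * diam U ^+ s else +oo.

Definition hausdorff_outer (A : set 'rV[R]_nu) : \bar R :=
  ereal_sup [set cover_outer (hausdorff_weight delta) A |
             delta in [set delta : R | (0 < delta)%R]].

Lemma ball_volume_ge0 n : (0 <= ball_volume R n)%R.
Proof.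
suff: (0 <= ball_volume R n)%R /\ (0 <= ball_volume R n.+1)%R by case.
elim: n => [|n [IH1 IH2]]; first by rewrite /= ler01 ler0n.
by split=> //=; rewrite !mulr_ge0// ?invr_ge0// pi_ge0.
Qed.

Lemma hausdorff_weight_ge0 delta U : 0 <= hausdorff_weight delta U.
Proof.
rewrite /hausdorff_weight; case: asboolP => // -[[x Ux] _].
rewrite mule_ge0 ?lee_fin ?divr_ge0 ?ball_volume_ge0 ?exprn_ge0//.
apply: expe_ge0; apply: ereal_sup_ubound; exists (x, x) => //=.
congr EFin; rewrite subrr /enorm big1 ?sqrtr0// => j _.
by rewrite mxE expr0n.
Qed.

Lemma hausdorff_outer_ge0 A : 0 <= hausdorff_outer A.
Proof.
apply: (le_trans (cover_outer_ge0 (hausdorff_weight_ge0 1%R) A)).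
by apply: ereal_sup_ubound; exists 1%R => //=.
Qed.

Lemma hausdorff_outer0 : hausdorff_outer set0 = 0.
Proof.
apply/eqP; rewrite eq_le hausdorff_outer_ge0 andbT.
apply: ge_ereal_sup => _ [e _ <-]; rewrite cover_outer0//.
exact: hausdorff_weight_ge0.
Qed.

Lemma hausdorff_outer_le :
  {homo hausdorff_outer : A B / A `<=` B >-> A <= B}.
Proof.
move=> A B AB; apply: ge_ereal_sup => _ [e e0 <-].
apply: (le_trans (@cover_outer_le _ _ (hausdorff_weight e) _ _ AB)).
by apply: ereal_sup_ubound; exists e.
Qed.

Lemma hausdorff_outer_sigma_subadditive : sigma_subadditive hausdorff_outer.
Proof.
move=> F; apply: ge_ereal_sup => _ [e e0 <-].
have ge0 := hausdorff_weight_ge0 e.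
apply: (le_trans (cover_outer_sigma_subadditive ge0 F)).
apply: lee_nneseries => [i _ _|i _]; first exact: cover_outer_ge0.
by apply: ereal_sup_ubound; exists e.
Qed.

HB.instance Definition _ := isOuterMeasure.Build R 'rV[R]_nu hausdorff_outer
  hausdorff_outer0 hausdorff_outer_ge0 hausdorff_outer_le
  hausdorff_outer_sigma_subadditive.

(* s-dimensional Hausdorff measure, normalised to agree with s-dimensional
   surface area. *)
Definition hausdorff_measure := caratheodory_measure hausdorff_outer.

End Hausdorff.

(* A cell of a mesh of R^nu is given by its vertices, numbered among the n nodes
   of the mesh: a simplex (triangle, tetrahedron), with affine shape functions,
   or the image of the unit cube (quadrilateral, hexahedron), with multilinear
   shape functions. *)
Inductive cell (nu n : nat) :=
| Simplex of 'I_nu.+1 -> 'I_n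
| Cuboid of {ffun 'I_nu -> bool} -> 'I_n.

Record mesh (R : realType) (nu : nat) := Mesh {
  num_nodes : nat;
  node : 'I_num_nodes -> 'rV[R]_nu;
  num_cells : nat;
  cells : 'I_num_cells -> cell nu num_nodes }.

Section Cells.
Context {R : realType} {nu : nat}.
Implicit Types (n : nat) (xi : 'rV[R]_nu).

Definition barycentric (a : 'I_nu.+1) xi : R :=
  if unlift ord0 a is Some j then xi ord0 j else 1 - \sum_(j < nu) xi ord0 j.

Definition multilinear (b : {ffun 'I_nu -> bool}) xi : R :=
  \prod_(j < nu) (if b j then xi ord0 j else 1 - xi ord0 j).

Definition is_vertex n (K : cell nu n) (r : 'I_n) : Prop :=
  match K with
  | Simplex g => exists a, g a = r
  | Cuboid g => exists b, g b = r
  end.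

Definition ref_cell n (K : cell nu n) : set 'rV[R]_nu :=
  match K with
  | Simplex _ => [set xi | forall a, 0 <= barycentric a xi]
  | Cuboid _ => [set xi | forall j, 0 <= xi ord0 j <= 1]
  end.

Definition ref_facets n (K : cell nu n) : set (set 'rV[R]_nu) :=
  match K with
  | Simplex _ => [set ref_cell K `&` [set xi | barycentric a xi = 0] |
                  a in [set: 'I_nu.+1]]
  | Cuboid _ => [set ref_cell K `&` [set xi | xi ord0 jb.1 = jb.2%:R] |
                 jb in [set: 'I_nu * bool]]
  end.

(* Faces of every dimension, the whole cell and the empty set included. *)
Definition ref_faces n (K : cell nu n) : set (set 'rV[R]_nu) :=
  [set ref_cell K `&` \bigcap_(F in A) F |
   A in [set A : set (set 'rV[R]_nu) | A `<=` ref_facets K]].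

(* The function on the reference cell with prescribed vertex values w. *)
Definition interp (V : lmodType R) n (K : cell nu n) (w : 'I_n -> V) xi : V :=
  match K with
  | Simplex g => \sum_a barycentric a xi *: w (g a)
  | Cuboid g => \sum_b multilinear b xi *: w (g b)
  end.

Variable m : mesh R nu.

Definition cell_map (c : 'I_(num_cells m)) : 'rV[R]_nu -> 'rV[R]_nu :=
  interp (cells c) (@node R nu m).

Definition cell_set (c : 'I_(num_cells m)) : set 'rV[R]_nu :=
  cell_map c @` ref_cell (cells c).

Definition cell_faces (c : 'I_(num_cells m)) : set (set 'rV[R]_nu) :=
  [set cell_map c @` f | f in ref_faces (cells c)].

Definition cell_facets (c : 'I_(num_cells m)) : set (set 'rV[R]_nu) :=
  [set cell_map c @` f | f in ref_facets (cells c)].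

(* The reference map is a bi-Lipschitz homeomorphism onto the cell (the upper
   Lipschitz bound is automatic). For a simplex this says that the vertices are
   affinely independent. *)
Definition nondegenerate (c : 'I_(num_cells m)) : Prop :=
  exists2 kappa : R, 0 < kappa &
    {in ref_cell (cells c) &, forall xi eta,
      kappa * enorm (xi - eta) <= enorm (cell_map c xi - cell_map c eta)}.

Record fe_partition (Om : set 'rV[R]_nu) : Prop := {
  node_inj : injective (@node R nu m);
  node_vertex : forall r, exists c, is_vertex (cells (m := m) c) r;
  cell_nondegenerate : forall c, nondegenerate c;
  cell_cover : closure Om = \bigcup_(c in [set: 'I_(num_cells m)]) cell_set c;
  cell_disjoint : forall c c', c != c' ->
    (cell_set c)° `&` (cell_set c')° = set0;
  cell_conforming : forall c c', c != c' ->
    (cell_faces c `&` cell_faces c') (cell_set c `&` cell_set c') }.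

(* Mesh size h, regularity constant sigma. *)
Definition quasi_uniform (h sigma : R) : Prop :=
  forall c,
    (forall x y, cell_set c x -> cell_set c y -> enorm (x - y) <= h) /\
    (exists z, [set x | enorm (x - z) <= sigma * h] `<=` cell_set c).

(* The facets of the mesh that lie on gamma make up gamma (up to closure): they
   form the partition of gamma induced by the mesh. *)
Definition induces_partition (gamma : set 'rV[R]_nu) : Prop :=
  closure gamma =
  \bigcup_(F in [set F | (exists c, cell_facets c F) /\ F `<=` closure gamma]) F.

(* S^h: continuous functions on the closure of Om (values elsewhere are
   irrelevant) that are affine, resp. multilinear, in the reference coordinates
   of each cell. *)
Definition fe_space (Om : set 'rV[R]_nu) : set ('rV[R]_nu -> R) :=
  [set v | {within closure Om, continuous v} /\
    forall c, exists w : 'I_(num_nodes m) -> R^o,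
      {in ref_cell (cells c), forall xi,
        v (cell_map c xi) = interp (cells c) w xi}].

Definition nodal_basis (Om : set 'rV[R]_nu)
    (N : 'I_(num_nodes m) -> 'rV[R]_nu -> R) : Prop :=
  (forall r, fe_space Om (N r)) /\
  (forall r t, N r (node t) = (r == t)%:R).

End Cells.

Variant side := side1 | side2.
Variant node_kind := Interface | Interior.

(* gamma is taken relatively open: its end points (nu = 2) or edge (nu = 3) on
   the boundary of Omega belong to the sets Gamma_i. *)
Record two_subdomains (R : realType) (nu : nat) (Omega gamma : set 'rV[R]_nu)
    (Om : side -> set 'rV[R]_nu) : Prop := {
  region_open : open Omega;
  region_connected : connected Omega;
  region_bounded : bounded_set Omega;
  subdomain_open : forall i, open (Om i);
  subdomain_nonempty : forall i, Om i !=set0;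
  subdomain_sub : forall i, Om i `<=` Omega;
  subdomain_disjoint : Om side1 `&` Om side2 = set0;
  interfaceE : gamma = Omega `\` (Om side1 `|` Om side2);
  interface_boundary : forall i, gamma `<=` boundary (Om i) }.

(* No property is built in: see fe_partition and nodal_basis. *)
Record fe_subdomain (R : realType) (nu : nat) := FESubdomain {
  dom : set 'rV[R]_nu;
  msh : mesh R nu;
  basis_fun : 'I_(num_nodes msh) -> 'rV[R]_nu -> R }.

Section Blocks.
Context {R : realType} {nu : nat}.
Variable gamma : set 'rV[R]_nu.
Implicit Types (D : fe_subdomain R nu) (p q : node_kind).

Definition outer_boundary D : set 'rV[R]_nu := boundary (dom D) `\` gamma.

Definition dirichlet_nodes D : {set 'I_(num_nodes (msh D))} :=
  [set r | `[< outer_boundary D (node r) >]]%SET.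

Definition interface_nodes D : {set 'I_(num_nodes (msh D))} :=
  [set r | `[< gamma (node r) >] & r \notin dirichlet_nodes D]%SET.

Definition interior_nodes D : {set 'I_(num_nodes (msh D))} :=
  (~: (dirichlet_nodes D :|: interface_nodes D))%SET.

Definition nodes p D : {set 'I_(num_nodes (msh D))} :=
  match p with
  | Interface => interface_nodes D
  | Interior => interior_nodes D
  end.

(* Block M_pq of the mass matrix. *)
Definition mass D p q : 'M[R]_(#|nodes p D|, #|nodes q D|) :=
  \matrix_(r, t) \int[@lebesgue_rV R nu]_(x in dom D)
    (basis_fun (enum_val r) x * basis_fun (enum_val t) x).

(* Block G_gamma of D, for multipliers in the trace space of E. *)
Definition coupling E D : 'M[R]_(#|nodes Interface E|, #|nodes Interface D|) :=
  \matrix_(r, t) \int[@hausdorff_measure R nu nu.-1]_(x in gamma)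
    (basis_fun (enum_val r) x * basis_fun (enum_val t) x).

End Blocks.

(* Phi consists of the first d columns of U, for some singular value
   decomposition X = U S V^T of the snapshot matrix X. *)
Definition pod_basis (R : realType) (n s d : nat) (X : 'M[R]_(n, s))
    (Phi : 'M[R]_(n, d)) : Prop :=
  exists (U : 'M[R]_n) (V : 'M[R]_s) (sv : nat -> R),
    [/\ U^T *m U = 1%:M, V^T *m V = 1%:M,
        (forall j, 0 <= sv j.+1 <= sv j),
        X = U *m (\matrix_(r, t) (if r == t :> nat then sv r else 0)) *m V^T &
        forall r (j : 'I_d) (j' : 'I_n), j = j' :> nat -> Phi r j = U r j'].

Section ReducedProblem.
Context {R : realType} {nu : nat}.
Variables (gamma : set 'rV[R]_nu) (D : side -> fe_subdomain R nu) (k : side).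
Variable d : side -> node_kind -> nat.
Variable Phi : forall i p, 'M[R]_(#|nodes gamma p (D i)|, d i p).

Definition reduced_mass_block i p q : 'M[R]_(d i p, d i q) :=
  (Phi i p)^T *m mass gamma (D i) p q *m Phi i q.

Definition reduced_mass i : 'M[R]_(d i Interface + d i Interior) :=
  block_mx (reduced_mass_block i Interface Interface)
           (reduced_mass_block i Interface Interior)
           (reduced_mass_block i Interior Interface)
           (reduced_mass_block i Interior Interior).

Definition reduced_coupling i :
    'M[R]_(d k Interface, d i Interface + d i Interior) :=
  row_mx ((Phi k Interface)^T *m coupling gamma (D k) (D i) *m Phi i Interface)
         (0 : 'M[R]_(d k Interface, d i Interior)).

Definition schur_complement : 'M[R]_(d k Interface) :=
  reduced_coupling side1 *m invmx (reduced_mass side1)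
    *m (reduced_coupling side1)^T +
  reduced_coupling side2 *m invmx (reduced_mass side2)
    *m (reduced_coupling side2)^T.

End ReducedProblem.

Definition symmetric_mx (R : realType) (n : nat) (A : 'M[R]_n) : Prop :=
  A^T = A.

Definition positive_definite (R : realType) (n : nat) (A : 'M[R]_n) : Prop :=
  forall v : 'cV[R]_n, v != 0 -> 0 < (v^T *m A *m v) ord0 ord0.

(* Main.v *)
Require Import Defs.
From HB Require Import structures.
From mathcomp Require Import all_boot all_order all_algebra.
From mathcomp Require Import all_classical all_reals all_analysis.
From mathcomp Require Import measurable_realfun ring lra zify.

Set Implicit Arguments.
Unset Strict Implicit.
Unset Printing Implicit Defensive.

Import Order.TTheory GRing.Theory Num.Theory.
Import numFieldNormedType.Exports.

Local Open Scope classical_set_scope.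
Local Open Scope ring_scope.

(** The quadratic form of [S] is the sum over the two sides of the forms of the
    inverse reduced mass matrices, evaluated at [G_i^T v]. Hence [S] is positive
    definite as soon as both reduced mass matrices are, and [G_k^T v] vanishes
    only for [v = 0] ([schur_sum]). The second point uses that the multiplier
    space is the trace space of side [k]: the nonzero block of [G_k] is then
    [Phi^T G Phi], where [G] is the Gram matrix in [L^2(gamma)] of the traces of
    the interface basis functions. The other coupling matrix may be anything,
    which is why meshes and reduced dimensions are unrestricted.

    So everything reduces to the positive definiteness of two Gram matrices of
    nodal basis functions, in [L^2(Omega_i)] and in [L^2(gamma)]; compression by
    matrices with orthonormal columns preserves it. A combination of nodal
    functions with a nonzero coefficient is nonzero at the corresponding node,
    hence bounded away from zero near it, and its square has a positive integral
    provided that ([nodal_gram_positive_definite])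
    - continuous functions are measurable;
    - the domain of integration has finite measure;
    - its intersection with every neighbourhood of a node has positive measure.

    The measures are given as outer measures built from covers. Measurability
    follows from additivity on sets on the two sides of a slab, by Caratheodory's
    metric argument ([sublevel_caratheodory], [open_caratheodory]). Positivity
    rests on the fact that boxes covering a box have at least its total volume
    ([box_cover]): this bounds the Lebesgue measure of a box, and, through a chart
    with Lipschitz inverse, the Hausdorff measure of a piece of facet
    ([hausdorff_outer_gt0], [cell_facets_gt0]). The interface, relatively closed
    in Omega, is covered by finitely many facets, Lipschitz images of pieces of
    hyperplanes, so its measure is finite ([hausdorff_outer_lty],
    [interface_lty]), and a node of the interface lies on one of these facets
    ([interface_gt0]). *)

(** * Positive definite matrices *)

Section PositiveDefinite.
Context {R : realType}.

Lemma positive_definite_unit n (A : 'M[R]_n) :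
  positive_definite A -> A \in unitmx.
Proof.
move=> Apd; rewrite -unitmx_tr -row_free_unit -kermx_eq0.
apply/negP => /negP/rowV0Pn[v] /sub_kermxP vA v0.
have := Apd v^T; rewrite trmx_eq0 => /(_ v0).
by rewrite -mulmxA -[A *m _]trmxK trmx_mul trmxK vA trmx0 mulmx0 mxE ltxx.
Qed.

Lemma quadratic_form0 n (A : 'M[R]_n) (v : 'cV[R]_n) :
  v = 0 -> (v^T *m A *m v) ord0 ord0 = 0.
Proof. by move=> ->; rewrite mulmx0 mxE. Qed.

Lemma positive_definite_ge0 n (A : 'M[R]_n) (v : 'cV[R]_n) :
  positive_definite A -> 0 <= (v^T *m A *m v) ord0 ord0.
Proof.
by have [/quadratic_form0->//|v0 /(_ _ v0)/ltW] := eqVneq v 0.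
Qed.

Lemma symmetric_inv n (A : 'M[R]_n) : symmetric_mx A -> symmetric_mx (invmx A).
Proof. by rewrite /symmetric_mx trmx_inv => ->. Qed.

Lemma positive_definite_inv n (A : 'M[R]_n) :
  symmetric_mx A -> positive_definite A -> positive_definite (invmx A).
Proof.
move=> As Apd v v0; have Au := positive_definite_unit Apd.
have := Apd (invmx A *m v).
rewrite trmx_mul (symmetric_inv As) -!mulmxA (mulmxA A) mulmxV// mul1mx.
apply; apply: contra_neq v0 => /(congr1 (mulmx A)).
by rewrite mulmxA mulmxV// mul1mx mulmx0.
Qed.

Lemma symmetric_congruence n m (A : 'M[R]_n) (B : 'M[R]_(m, n)) :
  symmetric_mx A -> symmetric_mx (B *m A *m B^T).
Proof. by move=> As; rewrite /symmetric_mx !trmx_mul trmxK As mulmxA. Qed.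

Lemma positive_definite_congruence n m (A : 'M[R]_n) (B : 'M[R]_(n, m)) :
  (forall v : 'cV_m, B *m v = 0 -> v = 0) ->
  positive_definite A -> positive_definite (B^T *m A *m B).
Proof.
move=> Binj Apd v v0; have := Apd (B *m v).
rewrite trmx_mul !mulmxA; apply.
by apply: contra_neq v0; apply: Binj.
Qed.

Lemma orthonormal_inj n m (B : 'M[R]_(n, m)) :
  B^T *m B = 1%:M -> forall v : 'cV_m, B *m v = 0 -> v = 0.
Proof.
by move=> BB v /(congr1 (mulmx B^T)); rewrite mulmxA BB mul1mx mulmx0.
Qed.

Lemma pod_basis_orthonormal n s d (X : 'M[R]_(n, s)) (Phi : 'M[R]_(n, d)) :
  (d <= n)%N -> pod_basis X Phi -> Phi^T *m Phi = 1%:M.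
Proof.
move=> dn [U [V [sv [UU _ _ _ PhiU]]]]; apply/matrixP => i j.
have w l : Phi l =1 fun j => U l (widen_ord dn j) by move=> a; exact: PhiU.
transitivity ((U^T *m U) (widen_ord dn i) (widen_ord dn j)).
  by rewrite !mxE; apply: eq_bigr => l _; rewrite !mxE !w.
by rewrite UU !mxE -val_eqE.
Qed.

(** Both terms of the quadratic form are nonnegative, so one transpose that is
    one-to-one suffices. *)
Lemma schur_sum n m1 m2 (G1 : 'M[R]_(n, m1)) (M1 : 'M[R]_m1)
    (G2 : 'M[R]_(n, m2)) (M2 : 'M[R]_m2) :
  (forall v : 'cV_n, G1^T *m v = 0 -> v = 0) ->
  symmetric_mx M1 -> positive_definite M1 ->
  symmetric_mx M2 -> positive_definite M2 ->
  positive_definite (G1 *m invmx M1 *m G1^T + G2 *m invmx M2 *m G2^T).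
Proof.
move=> G1inj M1s M1pd M2s M2pd v v0.
rewrite mulmxDr mulmxDl mxE.
rewrite ltr_wpDr//.
  have := @positive_definite_ge0 _ _ (G2^T *m v) (positive_definite_inv M2s M2pd).
  by rewrite trmx_mul trmxK !mulmxA.
rewrite -[X in X *m invmx M1]trmxK.
by apply: (positive_definite_congruence _ (positive_definite_inv M1s M1pd)).
Qed.

Lemma row_mx0_tr_inj n m1 m2 (G : 'M[R]_(n, m1)) :
  (forall v : 'cV_n, G^T *m v = 0 -> v = 0) ->
  forall v : 'cV_n, (row_mx G (0 : 'M[R]_(n, m2)))^T *m v = 0 -> v = 0.
Proof.
move=> Ginj v; rewrite tr_row_mx mul_col_mx => /eqP.
by rewrite col_mx_eq0 => /andP[/eqP/Ginj].
Qed.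

End PositiveDefinite.

(** * Gram matrices of bounded functions *)

Section Gram.
Context (d : measure_display) (T : measurableType d) (R : realType).
Variables (mu : {measure set T -> \bar R}) (A : set T).
Hypothesis mA : measurable A.
Hypothesis muA : (mu A < +oo)%E.

Definition bounded_measurable (f : T -> R) : Prop :=
  measurable_fun A f /\ exists M, forall x, A x -> `|f x| <= M.

Lemma bounded_measurable_integrable f :
  bounded_measurable f -> mu.-integrable A (EFin \o f).
Proof.
move=> [mf [M fM]]; apply: measurable_bounded_integrable => //.
exists M; split; first exact: num_real.
by move=> N MN x Ax; exact: le_trans (fM _ Ax) (ltW MN).
Qed.

Lemma bounded_measurableM f g : bounded_measurable f -> bounded_measurable g ->
  bounded_measurable (fun x => f x * g x).
Proof.
move=> [mf [M fM]] [mg [N gN]]; split; first exact: measurable_funM.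
exists (M * N) => x Ax; rewrite normrM.
by apply: ler_pM => //; [exact: fM|exact: gN].
Qed.

Lemma bounded_measurable_comb (I : finType) (v : I -> R) (f : I -> T -> R) :
  (forall i, bounded_measurable (f i)) ->
  bounded_measurable (fun x => \sum_i v i * f i x).
Proof.
move=> bf; split.
  by apply: measurable_sum => i; apply: measurable_funM => //; case: (bf i).
pose M i := sval (cid (bf i).2).
have fM i x : A x -> `|f i x| <= M i by exact: (svalP (cid (bf i).2)).
exists (\sum_i `|v i| * M i) => x Ax.
apply: le_trans (ler_norm_sum _ _ _) _.
by apply: ler_sum => i _; rewrite normrM ler_wpM2l// fM.
Qed.

Lemma Rintegral_sum (I : Type) (s : seq I) (f : I -> T -> R) :
  (forall i, mu.-integrable A (EFin \o f i)) ->
  \int[mu]_(x in A) (\sum_(i <- s) f i x) = \sum_(i <- s) \int[mu]_(x in A) f i x.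
Proof.
move=> intf; elim: s => [|i s IH].
  rewrite big_nil -[RHS](mul0r (fine (mu A))) -Rintegral_cst//.
  by apply: eq_Rintegral => x _; rewrite big_nil.
rewrite big_cons -IH -RintegralD//; last first.
  have /(_ s xpredT) := @integrable_sum _ _ _ mu A mA I _ _ _ (fun i _ => intf i).
  apply: eq_integrable => // x _ /=.
  by rewrite sumEFin.
by apply: eq_Rintegral => x _; rewrite big_cons.
Qed.

(** Bilinearity of the product of [L^2]; boundedness and the finite measure of
    [A] make every term of the expanded square integrable. *)
Lemma gram_form m (f : 'I_m -> T -> R) (v : 'cV[R]_m) :
  (forall i, bounded_measurable (f i)) ->
  (v^T *m (\matrix_(r, t) \int[mu]_(x in A) (f r x * f t x)) *m v) ord0 ord0 =
  \int[mu]_(x in A) ((\sum_i v i ord0 * f i x) ^+ 2).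
Proof.
move=> bf.
have int2 i j : mu.-integrable A (EFin \o (fun x => f i x * f j x)).
  exact/bounded_measurable_integrable/bounded_measurableM.
have bc g a : bounded_measurable g -> bounded_measurable (fun x => a * g x).
  move=> bg; apply: bounded_measurableM bg; split; first exact: measurable_cst.
  by exists `|a|.
transitivity (\sum_j \sum_i \int[mu]_(x in A)
    (v i ord0 * v j ord0 * (f i x * f j x))).
  rewrite mxE; apply: eq_bigr => j _.
  rewrite mxE mulr_suml; apply: eq_bigr => i _.
  by rewrite !mxE RintegralZl// mulrAC.
transitivity (\sum_j \int[mu]_(x in A)
    (\sum_i v i ord0 * v j ord0 * (f i x * f j x))).
  apply: eq_bigr => j _; rewrite Rintegral_sum// => i.
  exact/bounded_measurable_integrable/bc/bounded_measurableM.
rewrite -Rintegral_sum; last first.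
  move=> j; apply: bounded_measurable_integrable.
  by apply: bounded_measurable_comb => i; exact: bounded_measurableM.
apply: eq_Rintegral => x _.
rewrite expr2 mulr_sumr; apply: eq_bigr => j _; rewrite mulr_suml.
by apply: eq_bigr => i _; rewrite mulrACA.
Qed.

Lemma gram_symmetric m (f : 'I_m -> T -> R) :
  symmetric_mx (\matrix_(r, t) \int[mu]_(x in A) (f r x * f t x)).
Proof.
apply/matrixP => r t; rewrite !mxE; apply: eq_Rintegral => x _.
by rewrite mulrC.
Qed.

(** The square of the combination is at least [e ^+ 2] on [B]. *)
Lemma gram_positive_definite m (f : 'I_m -> T -> R) :
  (forall i, bounded_measurable (f i)) ->
  (forall v : 'cV[R]_m, v != 0 -> exists B e, [/\ measurable B, B `<=` A,
    (0 < mu B)%E, 0 < e & forall x, B x -> e <= `|\sum_i v i ord0 * f i x|]) ->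
  positive_definite (\matrix_(r, t) \int[mu]_(x in A) (f r x * f t x)).
Proof.
move=> bf sep v v0; rewrite gram_form//.
have [B [e [mB BA muB e0 eB]]] := sep _ v0.
set g := fun x => (\sum_i v i ord0 * f i x) ^+ 2.
have bg : bounded_measurable g.
  have bs := bounded_measurable_comb (fun i => v i ord0) bf.
  exact: (bounded_measurableM bs bs).
have ig := bounded_measurable_integrable bg.
have mg : measurable_fun A (EFin \o g) by apply/measurable_EFinP; case: bg.
have pos : (0 < \int[mu]_(x in A) (g x)%:E)%E.
  apply: (@lt_le_trans _ _ ((e ^+ 2)%:E * mu B)%E).
    by rewrite mule_gt0// lte_fin exprn_gt0.
  rewrite -integral_cst//.
  apply: (@le_trans _ _ (\int[mu]_(x in B) (g x)%:E)%E); last first.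
    by apply: ge0_subset_integral => // x _; rewrite lee_fin sqr_ge0.
  apply: ge0_le_integral => //=.
  - by move=> x _; rewrite lee_fin sqr_ge0.
  - exact: measurable_funS mg.
  - move=> x Bx; rewrite lee_fin /g -[leRHS](real_normK (num_real _)).
    by rewrite lerXn2r ?nnegrE ?normr_ge0 ?(ltW e0)// eB.
by rewrite fine_gt0// pos/= integrable_lty.
Qed.

End Gram.

(** * Borel sets are measurable *)

Lemma ball_rV (R : realType) n (x y : 'rV[R]_n) e : 0 < e ->
  ball x e y <-> forall j, `|x ord0 j - y ord0 j| < e.
Proof.
move=> e0; split => [[_ xy] j|xy]; first exact: xy.
by split => // i j; rewrite ord1; exact: xy.
Qed.

Section MetricOuterMeasure.
Context (T : Type) (R : realType) (mu : {outer_measure set T -> \bar R}).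
Variable f : T -> R.
Hypothesis mu_sep : forall c c' A B, c < c' -> (forall x, A x -> f x <= c) ->
  (forall x, B x -> c' <= f x) -> (mu A + mu B <= mu (A `|` B))%E.
Local Open Scope ereal_scope.

(** The classical argument for Caratheodory's criterion: the sublevel set is at
    positive distance from the part of [X] where [f] is at least [c + 1/(n+1)],
    and what remains is a union of layers; every other layer is separated from
    the previous ones, so that the sum of their measures is at most [mu X] and
    the tails vanish. *)
Lemma sublevel_caratheodory c : mu.-caratheodory [set x | (f x <= c)%R].
Proof.
apply: le_caratheodory_measurable => X.
have [->|/eqP] := eqVneq (mu X) +oo; first exact: leey.
move=> /eqP; rewrite -ltey => muX.
(* Levels decreasing to [c], and the layers of [X] between them. *)
pose r n : R := (c + n.+1%:R^-1)%R.
have rS n m : (n < m)%N -> (r m < r n)%R.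
  by move=> nm; rewrite ltrD2l ltf_pV2 ?posrE ?ltr0n// ltr_nat.
have rW n m : (n <= m)%N -> (r m <= r n)%R.
  by rewrite leq_eqVlt => /predU1P[->//|/rS/ltW].
pose L n := X `&` [set x | (r n.+1 <= f x < r n)%R].
(* Every other layer, of either parity [p]; the layer [L 0] is left out so that
   the separating level [r (m.*2 + p)] below exists for [m = p = 0]. *)
pose u p k := mu (L (k.*2 + p).+1).
have partial p m : \sum_(0 <= k < m) u p k <=
    mu (X `&` [set x | (r (m.*2 + p)%N <= f x)%R]).
  elim: m => [|m IH]; first by rewrite big_geq ?outer_measure_ge0.
  rewrite big_nat_recr//=.
  apply: (@le_trans _ _ (mu (X `&` [set x | (r (m.*2 + p)%N <= f x)%R]) + u p m)).
    by rewrite leeD2r.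
  rewrite addeC; apply: le_trans.
    apply: (mu_sep (rS (m.*2 + p)%N (m.*2 + p).+1 _)) => // x.
    - by case=> _ /= /andP[_ /ltW].
    - by case.
  apply: le_outer_measure => x [[Xx /= /andP[h _]]|[Xx /= h]]; split => //=.
  by rewrite (le_trans _ h)// rW// doubleS !addSn ltnW.
have series p : \sum_(0 <= k <oo) u p k < +oo.
  apply: le_lt_trans muX; apply: lime_le.
    by apply: is_cvg_nneseries => n _ _; exact: outer_measure_ge0.
  by near=> m; apply: le_trans (partial p m) _; apply: le_outer_measure => x [].
have tail p : \sum_(N <= k <oo) u p k @[N --> \oo] --> 0.
  by apply: nneseries_tail_cvg => // k _; exact: outer_measure_ge0.
have bound N : mu (X `&` [set x | (f x <= c)%R]) +
    mu (X `&` ~` [set x | (f x <= c)%R]) <=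
    mu X + (\sum_(N <= k <oo) u 0%N k + \sum_(N <= k <oo) u 1%N k).
  set X1 := X `&` [set x | (r N.*2.+1 <= f x)%R].
  have cN : (c < r N.*2.+1)%R by rewrite ltrDl invr_gt0.
  apply: (@le_trans _ _ (mu (X `&` [set x | (f x <= c)%R]) + (mu X1 +
      (\sum_(N <= k <oo) u 0%N k + \sum_(N <= k <oo) u 1%N k)))).
    rewrite leeD2l//.
    have tl p := outer_measure_sigma_subadditive_tail mu N
      (fun k => L (k.*2 + p).+1).
    apply: le_trans (leeD2l _ (leeD (tl 0%N) (tl 1%N))).
    apply: le_trans (leeD2l _ (outer_measureU2 _ _ _)).
    apply: le_trans (outer_measureU2 _ _ _).
    apply: le_outer_measure => x [Xx /= /negP]; rewrite -ltNge => cx.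
    have [h|h] := leP (r N.*2.+1) (f x); first by left.
    right.
    (* [x] lies below [r N.*2.+1]: find its layer and the parity of the latter. *)
    have ex : exists n, (r n <= f x)%R.
      have d0 : (0 < f x - c)%R by rewrite subr_gt0.
      exists (Num.truncn (f x - c)^-1).
      rewrite /r -lerBrDl -[leRHS]invrK lef_pV2 ?posrE ?invr_gt0 ?ltr0n//.
      exact/ltW/truncnS_gt.
    case: (ex_minnP ex) => n nx nmin.
    have Nn : (N.*2.+1 < n)%N.
      by rewrite ltnNge; apply/negP => /rW/le_trans/(_ nx); rewrite leNgt h.
    case: n => // n in nx nmin Nn *.
    have xn : (f x < r n)%R by rewrite ltNge; apply/negP => /nmin; rewrite ltnn.
    have Lx : L n x by split => //=; rewrite nx.
    have [k nk] : exists k, n = k.+1 by exists n.-1; case: n Nn {nx nmin xn Lx}.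
    rewrite {}nk in Lx Nn *.
    rewrite -(odd_double_half k) in Lx Nn.
    case: (odd k) in Lx Nn *.
    - right; exists k./2 => /=; last by rewrite addn1; rewrite add1n in Lx.
      apply/negP; rewrite -leqNgt.
      by move: Nn; rewrite -muln2; lia.
    - left; exists k./2 => /=; last by rewrite addn0; rewrite add0n in Lx.
      apply/negP; rewrite -leqNgt.
      by move: Nn; rewrite add0n !ltnS leq_double.
  rewrite addeA leeD2r//.
  apply: le_trans (mu_sep cN _ _) _ => [x []//|x []//|].
  by apply: le_outer_measure => x [] [].
have : mu X + (\sum_(N <= k <oo) u 0%N k + \sum_(N <= k <oo) u 1%N k)
    @[N --> \oo] --> mu X + (0 + 0).
  apply: cvgeD; [|exact: cvg_cst|by apply: cvgeD].
  by rewrite adde0 fin_num_adde_defl.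
rewrite !adde0; apply: cvge_ge; apply: nearW; exact: bound.
Unshelve. all: by end_near. Qed.

End MetricOuterMeasure.

Section Borel.
Context (R : realType) (n : nat) (mu : {outer_measure set 'rV[R]_n -> \bar R}).

(** Only sets on the two sides of a slab orthogonal to a coordinate axis are
    considered: this part of the metric criterion is enough for half-spaces. *)
Definition separated_additive : Prop :=
  forall (j : 'I_n) (c c' : R) (A B : set 'rV[R]_n), c < c' ->
    (forall x, A x -> x ord0 j <= c) -> (forall x, B x -> c' <= x ord0 j) ->
    (mu A + mu B <= mu (A `|` B))%E.

Hypothesis mu_sep : separated_additive.

Let halfspace_measurable (j : 'I_n) (c : R) :
  measurable ([set x | x ord0 j <= c] : set (caratheodory_type mu)).
Proof. by apply: sublevel_caratheodory => c1 c2 A B; exact: mu_sep. Qed.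

(** An open set is the union of the boxes with rational centre and half-side
    [1 / (k + 1)] that it contains, and such a box is cut out by half-spaces. *)
Lemma open_caratheodory (O : set 'rV[R]_n) :
  open O -> measurable (O : set (caratheodory_type mu)).
Proof.
move=> oO.
pose e k : R := k.+1%:R^-1.
pose box (qk : 'rV[rat]_n * nat) : set 'rV[R]_n := [set y | forall j,
  ratr (qk.1 ord0 j) - e qk.2 < y ord0 j <= ratr (qk.1 ord0 j) + e qk.2].
have -> : O = \bigcup_(qk : 'rV[rat]_n * nat)
    (if `[< box qk `<=` O >] then box qk else set0).
  apply/seteqP; split => [x Ox|x [qk _]]; last first.
    by case: asboolP => // sub /sub.
  have [d /= d0 xO] : exists2 d : R, 0 < d & ball x d `<=` O.
    by have /nbhs_ballP := open_nbhs_nbhs (conj oO Ox).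
  (* A point of the box around [x] is at distance less than twice the half-side. *)
  pose k := Num.truncn (2 / d).
  have k0 : 0 < e k by rewrite invr_gt0.
  have kd : 2 * e k < d.
    rewrite -ltr_pdivlMl// -[ltRHS]invrK invfM invrK ltf_pV2 ?posrE//.
    - exact: truncnS_gt.
    - by rewrite divr_gt0.
  have near_rat j : {q : rat | ratr q \in `](x ord0 j - e k), (x ord0 j + e k)[}.
    by apply: cid; apply: rat_in_itvoo; rewrite ltrD2l gtrN.
  pose q : 'rV[rat]_n := \row_j sval (near_rat j).
  exists (q, k) => //=.
  have qP j : x ord0 j - e k < ratr (q ord0 j) < x ord0 j + e k.
    by rewrite mxE; have := svalP (near_rat j); rewrite in_itv.
  case: asboolP => [_ j /=|].
    by have := qP j; set a := ratr _; move=> /andP[? ?]; apply/andP; split; lra.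
  case=> y /= yq; apply: xO; apply/ball_rV => // j.
  have := qP j; have := yq j; set a := ratr _.
  move=> /andP[? ?] /andP[? ?]; rewrite ltr_norml; apply/andP; split; lra.
apply: countable_bigcupT_measurable => // qk.
case: ifP => // _.
have -> : box qk = \bigcap_(j in [set: 'I_n])
    (~` [set y | y ord0 j <= ratr (qk.1 ord0 j) - e qk.2] `&`
     [set y | y ord0 j <= ratr (qk.1 ord0 j) + e qk.2]).
  apply/seteqP; split => y yP j.
    move=> _; split; last by case/andP: (yP j).
    by apply/negP; rewrite -ltNge; case/andP: (yP j).
  have [/= /negP] := yP j I.
  by rewrite -ltNge => ->.
apply: fin_bigcap_measurable => // j _.
by apply: measurableI; [apply: measurableC|]; exact: halfspace_measurable.
Qed.

Lemma continuous_caratheodory (A C : set 'rV[R]_n) (f : 'rV[R]_n -> R) :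
  measurable (A : set (caratheodory_type mu)) -> A `<=` C ->
  {within C, continuous f} ->
  measurable_fun (A : set (caratheodory_type mu)) f.
Proof.
move=> mA AC cf.
have cfA : {within A, continuous f} by exact: continuous_subspaceW cf.
apply: (measurability _ (RGenOpens.measurableE R)) => _ [_ [a [b ->]] <-].
have /continuousP cA := cfA.
have oab : open `]a, b[%classic by exact: interval_open.
have [V oV VA] := (open_subspaceP _ _).1 (cA _ oab).
rewrite setIC -VA; apply: measurableI => //.
exact: open_caratheodory.
Qed.

End Borel.

(** * Lebesgue and Hausdorff outer measures add on separated sets *)

Section EuclideanNorm.
Context {R : realType} {n : nat}.
Implicit Types x : 'rV[R]_n.

Lemma coord_le_enorm x j : `|x ord0 j| <= enorm x.
Proof.
rewrite /enorm -sqrtr_sqr ler_wsqrtr// (bigD1 j)//= lerDl.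
by apply: sumr_ge0 => i _; exact: sqr_ge0.
Qed.

Lemma enorm_le_coord x (a : R) : 0 <= a -> (forall j, `|x ord0 j| <= a) ->
  enorm x <= n%:R * a.
Proof.
move=> a0 xa; rewrite -[leRHS]ger0_norm ?mulr_ge0// -sqrtr_sqr ler_wsqrtr//.
apply: (@le_trans _ _ (\sum_(j < n) a ^+ 2)).
  apply: ler_sum => j _; rewrite -(real_normK (num_real _)).
  by rewrite lerXn2r ?nnegrE.
rewrite sumr_const card_ord -[a ^+ 2 *+ n]mulr_natl exprMn ler_wpM2r ?sqr_ge0//.
by rewrite -natrX ler_nat; case: (n) => // k; rewrite expnS leq_pmulr// expn_gt0.
Qed.

End EuclideanNorm.

Section CoverOuterTheory.
Context {R : realType} {T : pointedType}.
Variable tau : set T -> \bar R.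
Hypothesis tau_ge0 : forall U, (0 <= tau U)%E.
Local Open Scope ereal_scope.

Lemma weight0_ge0 U : 0 <= weight0 tau U.
Proof. by rewrite /weight0; case: asboolP. Qed.

Lemma weight0_set0 : weight0 tau set0 = 0.
Proof. by rewrite /weight0; case: asboolP. Qed.

Lemma weight0_le U V : (V !=set0 -> tau V <= tau U) -> V `<=` U ->
  weight0 tau V <= weight0 tau U.
Proof.
move=> VU sVU; have [->|/set0P V0] := eqVneq V set0.
  by rewrite weight0_set0 weight0_ge0.
rewrite /weight0; case: asboolP => [V00|_]; first by move: V0; rewrite V00 => -[].
by case: asboolP => [U0|_]; [move: V0 => [x /sVU]; rewrite U0|exact: VU].
Qed.

(** A cover of the union, intersected with [A] and with [B], gives one of each. *)
Lemma cover_outerD_le A B :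
  (forall U, weight0 tau (U `&` A) + weight0 tau (U `&` B) <= weight0 tau U) ->
  cover_outer tau A + cover_outer tau B <= cover_outer tau (A `|` B).
Proof.
move=> sep; apply: le_ereal_inf_tmp => _ [U /= ABU <-].
apply: (@le_trans _ _ (\sum_(k <oo) weight0 tau (U k `&` A) +
                       \sum_(k <oo) weight0 tau (U k `&` B))); last first.
  rewrite -nneseriesD; [|by move=> *; exact: weight0_ge0..].
  by apply: lee_nneseries => *; [exact: adde_ge0 (weight0_ge0 _) (weight0_ge0 _)|].
apply: leeD; apply: ereal_inf_lbound => /=.
- exists (fun k => U k `&` A) => // x Ax.
  by have [k _ Ux] := ABU x (or_introl Ax); exists k.
- exists (fun k => U k `&` B) => // x Bx.
  by have [k _ Ux] := ABU x (or_intror Bx); exists k.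
Qed.

Lemma cover_outer_le_weight (A : set T) : cover_outer tau A <= weight0 tau A.
Proof.
apply: ge_ereal_inf; exists (weight0 tau A) => //=.
exists (fun k => if k is 0%N then A else set0); first by move=> x Ax; exists 0%N.
rewrite nneseries_recl//; last by move=> *; exact: weight0_ge0.
by rewrite eseries_cond/= eseries0 ?adde0// => -[]//= k _ _; exact: weight0_set0.
Qed.

End CoverOuterTheory.

(** A box containing points of both [A] and [B] is cut in two at height [c], and
    the volumes of the two parts add up. *)
Lemma lebesgue_outer_separated (R : realType) n :
  @separated_additive R n (@lebesgue_outer R n).
Proof.
move=> j c c' A B cc' Ac Bc'; apply: cover_outerD_le.
  exact: box_volume_ge0.
have mono (V U : set 'rV[R]_n) : V `<=` U ->
    (weight0 (@box_volume R n) V <= weight0 (@box_volume R n) U)%E.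
  move=> VU; apply: weight0_le => //; first exact: box_volume_ge0.
  move=> _; apply: ereal_inf_le_tmp => _ [ab [ab0 abU] <-].
  by exists ab => //; split => //; exact: subset_trans abU.
move=> U.
have [->|/set0P[x [Ux Ax]]] := eqVneq (U `&` A) set0.
  by rewrite weight0_set0 add0e; apply: mono => x [].
have [->|/set0P[y [Uy By]]] := eqVneq (U `&` B) set0.
  by rewrite weight0_set0 adde0; apply: mono => z [].
rewrite /weight0; case: asboolP => [e|_].
  by have : set0 x by rewrite -e.
case: asboolP => [e|_]; first by have : set0 y by rewrite -e.
case: asboolP => [e|_]; first by have : set0 x by rewrite -e.
apply: le_ereal_inf_tmp => _ [[a b] [/= ab Uab] <-].
pose b' : 'rV[R]_n := \row_i (if i == j then c else b ord0 i).
pose a' : 'rV[R]_n := \row_i (if i == j then c else a ord0 i).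
have ac : a ord0 j <= c.
  by have /(_ j)/andP[h _] := Uab _ Ux; exact: le_trans h (Ac _ Ax).
have cb : c <= b ord0 j.
  have /(_ j)/andP[_ h] := Uab _ Uy.
  exact: le_trans (ltW cc') (le_trans (Bc' _ By) h).
apply: (@le_trans _ _ ((\prod_(i < n) (b' ord0 i - a ord0 i))%:E +
                       (\prod_(i < n) (b ord0 i - a' ord0 i))%:E)%E).
  apply: leeD; apply: ereal_inf_lbound => /=.
  - exists (a, b') => //=; split => [i|z [Uz Az] i].
      by rewrite mxE; case: eqP => [->|].
    rewrite mxE; have /(_ i)/andP[-> h] := Uab _ Uz.
    by case: eqP => [->|//]; rewrite Ac.
  - exists (a', b) => //=; split => [i|z [Uz Bz] i].
      by rewrite mxE; case: eqP => [->|].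
    rewrite mxE; have /(_ i)/andP[h ->] := Uab _ Uz; rewrite andbT.
    by case: eqP => [->|//]; rewrite (le_trans (ltW cc'))// Bc'.
rewrite -EFinD lee_fin (bigD1 j)//= [X in _ + X](bigD1 j)//= [leRHS](bigD1 j)//=.
rewrite !mxE eqxx.
rewrite (eq_bigr (fun i => b ord0 i - a ord0 i)); last first.
  by move=> i /negPf ij; rewrite mxE ij.
rewrite [X in _ + _ * X](eq_bigr (fun i => b ord0 i - a ord0 i)); last first.
  by move=> i /negPf ij; rewrite mxE ij.
by rewrite -mulrDl addrC addrA subrK.
Qed.

Section HausdorffSeparated.
Context {R : realType} {n : nat} (s : nat).
Implicit Types U V A B : set 'rV[R]_n.
Local Open Scope ereal_scope.

Lemma diam_le U V : V `<=` U -> diam V <= diam U.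
Proof.
move=> VU; apply: ereal_sup_le => _ [[x y] [/= Vx Vy] <-].
by exists (x, y) => //; split; exact: VU.
Qed.

Lemma enorm_le_diam U x y : U x -> U y -> (enorm (x - y))%:E <= diam U.
Proof. by move=> Ux Uy; apply: ereal_sup_ubound; exists (x, y). Qed.

Lemma diam_ge0 U : U !=set0 -> 0 <= diam U.
Proof.
move=> [x Ux]; apply: le_trans (enorm_le_diam Ux Ux).
by rewrite lee_fin sqrtr_ge0.
Qed.

Lemma lee_pX (x y : \bar R) k : 0 <= x -> x <= y -> x ^+ k <= y ^+ k.
Proof.
move=> x0 xy; elim: k => // k IH; rewrite !expeS.
by apply: lee_pmul => //; exact: expe_ge0.
Qed.

Lemma hausdorff_weight_le (delta : R) U V : V !=set0 -> V `<=` U ->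
  hausdorff_weight s delta V <= hausdorff_weight s delta U.
Proof.
move=> V0 VU; rewrite /hausdorff_weight.
case: (asboolP (U !=set0 /\ _)) => [[U0 dU]|_]; last exact: leey.
case: asboolP => [_|[]]; last by split => //; exact: le_trans (diam_le VU) dU.
apply: lee_wpmul2l; first by rewrite lee_fin divr_ge0// ball_volume_ge0.
by apply: lee_pX; [exact: diam_ge0|exact: diam_le].
Qed.

Lemma cover_hausdorff_le (delta delta' : R) A : (delta <= delta')%R ->
  cover_outer (hausdorff_weight s delta') A <=
  cover_outer (hausdorff_weight s delta) A.
Proof.
move=> dd; apply: le_ereal_inf_tmp => _ [U AU <-].
apply: ge_ereal_inf; eexists; first by exists U.
apply: lee_nneseries => [k _ _|k _].
  by apply: weight0_ge0 => W; exact: hausdorff_weight_ge0.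
rewrite /weight0; case: asboolP => // _; rewrite /hausdorff_weight.
case: (asboolP (_ /\ _ <= delta%:E)) => [[U0 dU]|_]; last exact: leey.
case: asboolP => [//|[]]; split => //; apply: le_trans dU _; exact: dd.
Qed.

Lemma cover_le_hausdorff (delta : R) A : (0 < delta)%R ->
  cover_outer (hausdorff_weight s delta) A <= @hausdorff_outer R n s A.
Proof. by move=> d0; apply: ereal_sup_ubound; exists delta. Qed.

(** A set of diameter at most half the width of the slab meets only one of the
    two sets, so fine covers of the union split. *)
Lemma hausdorff_outer_separated : @separated_additive R n (@hausdorff_outer R n s).
Proof.
move=> j c c' A B cc' Ac Bc'.
have key (d d' : R) : (0 < d)%R -> (0 < d')%R ->
    cover_outer (hausdorff_weight s d) A + cover_outer (hausdorff_weight s d') B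
    <= @hausdorff_outer R n s (A `|` B).
  move=> d0 d'0; pose m : R := Num.min (Num.min d d') ((c' - c) / 2)%R.
  have m0 : (0 < m)%R by rewrite !lt_min d0 d'0 divr_gt0 ?subr_gt0.
  apply: le_trans (cover_le_hausdorff _ m0).
  have md : (m <= d)%R by rewrite !ge_min lexx.
  have md' : (m <= d')%R by rewrite !ge_min lexx orbT.
  apply: le_trans (leeD (cover_hausdorff_le _ md) (cover_hausdorff_le _ md')) _.
  have hw0 (W : set 'rV[R]_n) : 0 <= hausdorff_weight s m W.
    exact: hausdorff_weight_ge0.
  apply: cover_outerD_le => // U.
  have mono V : V `<=` U -> weight0 (hausdorff_weight s m) V <=
                            weight0 (hausdorff_weight s m) U.
    by move=> VU; apply: weight0_le => // V0; exact: hausdorff_weight_le.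
  have [->|/set0P[x [Ux Ax]]] := eqVneq (U `&` A) set0.
    by rewrite weight0_set0 add0e; apply: mono => x [].
  have [->|/set0P[y [Uy By]]] := eqVneq (U `&` B) set0.
    by rewrite weight0_set0 adde0; apply: mono => z [].
  rewrite [leRHS]/weight0; case: asboolP => [U0|_].
    by have : set0 x by rewrite -U0.
  rewrite /hausdorff_weight; case: asboolP => [[_ dU]|_]; last exact: leey.
  have := le_trans (enorm_le_diam Uy Ux) dU; rewrite lee_fin => xym.
  have := le_trans (coord_le_enorm (y - x) j) xym.
  rewrite !mxE => /(le_trans (ler_norm _)) h.
  have m2 : (m <= (c' - c) / 2)%R by rewrite !ge_min lexx orbT.
  by exfalso; have := Ac _ Ax; have := Bc' _ By; lra.
pose M := @hausdorff_outer R n s (A `|` B).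
(* Both outer measures are suprema over their own diameter bound. *)
change (@hausdorff_outer R n s A + @hausdorff_outer R n s B <= M).
have [->|/eqP] := eqVneq M +oo; first exact: leey.
move=> /eqP; rewrite -ltey => Moo.
have sub C : C `<=` A `|` B -> @hausdorff_outer R n s C \is a fin_num.
  move=> CAB; rewrite ge0_fin_numE ?hausdorff_outer_ge0//.
  by apply: le_lt_trans Moo; exact: hausdorff_outer_le.
have fA := sub A (@subsetUl _ A B); have fB := sub B (@subsetUr _ A B).
rewrite -leeBrDr//; apply: ge_ereal_sup => _ [d /= d0 <-].
have fAd : cover_outer (hausdorff_weight s d) A \is a fin_num.
  rewrite ge0_fin_numE; last exact/cover_outer_ge0/hausdorff_weight_ge0.
  by rewrite (le_lt_trans (cover_le_hausdorff A d0))// -ge0_fin_numE ?hausdorff_outer_ge0.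
rewrite leeBrDr// addeC -leeBrDr//.
apply: ge_ereal_sup => _ [d' /= d'0 <-].
by rewrite leeBrDr// addeC key.
Qed.

End HausdorffSeparated.

(** * Covers of a box by boxes *)

Lemma lebesgue_measure_segment (R : realType) (a b : R) : a <= b ->
  lebesgue_measure (`[a, b]%classic : set R) = (b - a)%:E.
Proof.
rewrite le_eqVlt => /predU1P[->|ab].
  by rewrite subrr set_itv1 lebesgue_measure_set1.
by rewrite lebesgue_measure_itv/= lte_fin ab EFinB.
Qed.

(** Induction on the dimension: at each height [t], the boxes whose last side
    contains [t] project onto a cover of the projected box, and the resulting
    inequality is integrated over [t]. *)
Lemma box_cover (R : realType) n (a b : nat -> R) (P : pred nat)
    (A B : nat -> nat -> R) :
  (forall j, a j <= b j) -> (forall k j, P k -> A k j <= B k j) ->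
  (forall x : nat -> R, (forall j, (j < n)%N -> a j <= x j <= b j) ->
    exists2 k, P k & forall j, (j < n)%N -> A k j <= x j <= B k j) ->
  ((\prod_(j < n) (b j - a j))%:E <=
   \sum_(k <oo | P k) (\prod_(j < n) (B k j - A k j))%:E)%E.
Proof.
move=> ab; elim: n P => [|n IH] P AB cov.
  have [k Pk _] := cov a (fun j (h : (j < 0)%N) => ltac:(by [])).
  rewrite big_ord0.
  apply: (@le_trans _ _ (\sum_(0 <= i < k.+1 | P i)
      (\prod_(j < 0) (B i j - A i j))%:E)%E).
    rewrite big_mkcond big_nat_recr//= Pk big_ord0.
    rewrite leeDr//; apply: sume_ge0 => i _; case: ifP => // _.
    by rewrite big_ord0 lee_fin.
  by apply: nneseries_lim_ge => i _; rewrite big_ord0 lee_fin.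
pose w k : R := if P k then \prod_(j < n) (B k j - A k j) else 0.
have w0 k : 0 <= w k.
  rewrite /w; case: ifP => // Pk.
  by apply: prodr_ge0 => j _; rewrite subr_ge0 AB.
pose f k (t : R) := ((w k)%:E * (\1_(`[A k n, B k n]%classic) t)%:E)%E.
have f0 k t : (0 <= f k t)%E by rewrite mule_ge0 ?lee_fin.
have mf D k : measurable_fun (D : set R) (f k).
  apply: measurable_funeM; apply/measurable_EFinP.
  exact: measurable_indic.
pose mu := (@lebesgue_measure R).
pose D : set R := `[a n, b n]%classic.
have mD : measurable D by exact: measurable_itv.
have slice t : D t -> ((\prod_(j < n) (b j - a j))%:E <= \sum_(k <oo) f k t)%E.
  rewrite /D/= in_itv/= => tD.
  pose Pt k := P k && (A k n <= t <= B k n).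
  apply: (@le_trans _ _
      (\sum_(k <oo | Pt k) (\prod_(j < n) (B k j - A k j))%:E)%E).
    apply: IH => [k j /andP[Pk _]|x xab]; first exact: AB.
    pose y j := if j == n then t else x j.
    have [j|k Pk yk] := cov y.
      rewrite ltnS leq_eqVlt /y => /predU1P[->|jn]; first by rewrite eqxx.
      by rewrite ltn_eqF// xab.
    exists k; first by have := yk n (ltnSn n); rewrite /Pt Pk /y eqxx.
    by move=> j jn; have := yk j (ltnW jn); rewrite /y ltn_eqF.
  rewrite eseries_mkcond; apply: lee_nneseries => k _.
    case: ifP => // /andP[Pk _]; rewrite lee_fin prodr_ge0// => j _.
    by rewrite subr_ge0 AB.
  rewrite {}/Pt; case: ifP => [/andP[Pk tk]|_]; last exact: f0.
  by rewrite /f /w Pk indicE mem_setE in_itv/= tk mule1.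
have mono : (\int[mu]_(t in D) cst (\prod_(j < n) (b j - a j))%:E t <=
    \int[mu]_(t in setT) (\sum_(k <oo) f k t))%E.
  apply: (@le_trans _ _ (\int[mu]_(t in D) (\sum_(k <oo) f k t))%E).
    apply: ge0_le_integral => //=.
    - by move=> t _; rewrite lee_fin prodr_ge0// => j _; rewrite subr_ge0.
    - by apply: ge0_emeasurable_sum => [k t _ _|k _]; [exact: f0|exact: mf].
  apply: ge0_subset_integral => //.
  - by apply: ge0_emeasurable_sum => [k t _ _|k _]; [exact: f0|exact: mf].
  - by move=> t _; apply: nneseries_ge0 => k _ _; exact: f0.
rewrite integral_cst// in mono.
rewrite big_ord_recr/= EFinM -lebesgue_measure_segment//.
apply: le_trans mono _.
rewrite integral_nneseries; last 3 first.
- exact: measurableT.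
- by move=> k; exact: mf.
- by move=> k t _; exact: f0.
rewrite [leRHS]eseries_mkcond; apply: lee_nneseries => k _.
  by move=> _; apply: integral_ge0 => t _; exact: f0.
rewrite ge0_integralZl_EFin//; [|exact/measurable_EFinP/measurable_indic].
rewrite integral_indic// setIT /w; case: ifP => Pk; last by rewrite mul0e.
by rewrite big_ord_recr/= EFinM lebesgue_measure_segment// AB.
Qed.

(** * Lebesgue measure is positive on open sets and finite on bounded ones *)

Section Boxes.
Context {R : realType}.

Definition cbox n (a b : 'rV[R]_n) : set 'rV[R]_n :=
  [set x | forall j, a ord0 j <= x ord0 j <= b ord0 j].

Lemma box_cover_rV n (a b : 'rV[R]_n) (P : pred nat) (A B : nat -> 'rV[R]_n) :
  (forall j, a ord0 j <= b ord0 j) ->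
  (forall k j, P k -> A k ord0 j <= B k ord0 j) ->
  (forall x, cbox a b x -> exists2 k, P k & cbox (A k) (B k) x) ->
  ((\prod_(j < n) (b ord0 j - a ord0 j))%:E <=
   \sum_(k <oo | P k) (\prod_(j < n) (B k ord0 j - A k ord0 j))%:E)%E.
Proof.
move=> ab AB cov.
pose F (v : 'rV[R]_n) j := if insub j is Some i then v ord0 i else 0.
have FE v (j : 'I_n) : F v j = v ord0 j by rewrite /F valK.
have := @box_cover R n (F a) (F b) P (fun k => F (A k)) (fun k => F (B k)).
under [in X in (X <= _)%E]eq_bigr do rewrite !FE.
under [in X in (_ <= X)%E]eq_eseriesr => k _ do
  under eq_bigr do rewrite !FE.
apply.
- by move=> j; rewrite /F; case: insubP.
- by move=> k j Pk; rewrite /F; case: insubP => // i _ _; exact: AB.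
- move=> x xab; have [j|k Pk kx] := cov (\row_i x i).
    by rewrite mxE -!FE; exact: xab.
  exists k => // j jn; have := kx (Ordinal jn).
  by rewrite mxE -!FE.
Qed.

End Boxes.

Section CoverOuterBounds.
Context {R : realType} {T : pointedType}.
Variable tau : set T -> \bar R.
Hypothesis tau_ge0 : forall U, (0 <= tau U)%E.
Local Open Scope ereal_scope.

(** A cover with a set of infinite weight has an infinite sum. *)
Lemma cover_outer_ge (A : set T) (M : \bar R) :
  (forall U : (set T)^nat, A `<=` \bigcup_k U k ->
    (forall k, U k !=set0 -> tau (U k) < +oo) ->
    M <= \sum_(k <oo) weight0 tau (U k)) ->
  M <= cover_outer tau A.
Proof.
move=> MU; apply: le_ereal_inf_tmp => _ [U /= AU <-].
have [fin|] := pselect (forall k, U k !=set0 -> tau (U k) < +oo).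
  exact: MU.
move=> /existsNP[k /not_implyP[U0]]; rewrite ltey => /negP; rewrite negbK => /eqP kU.
rewrite (nneseries_pinfty (k := k)) ?leey// => [l _|]; first exact: weight0_ge0.
rewrite /weight0; case: asboolP => // Uk.
by move: U0; rewrite Uk => -[].
Qed.

Lemma cover_outer_le_seq (A : set T) (s : seq (set T)) :
  A `<=` \bigcup_k nth set0 s k ->
  cover_outer tau A <= \sum_(U <- s) weight0 tau U.
Proof.
move=> As; apply: ge_ereal_inf; eexists; first by exists (nth set0 s).
rewrite (nneseries_split 0 (size s)); last by move=> *; exact: weight0_ge0.
rewrite add0n eseries0 ?adde0; last first.
  by move=> i si _; rewrite nth_default// weight0_set0.
by rewrite [leRHS](big_nth set0).
Qed.

Lemma nneseries_weight0 (P : pred nat) (U : (set T)^nat) :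
  (forall k, P k -> U k !=set0) ->
  \sum_(k <oo | P k) tau (U k) <= \sum_(k <oo) weight0 tau (U k).
Proof.
move=> PU; rewrite eseries_mkcond; apply: lee_nneseries => k _.
  by case: ifP.
case: ifPn => [/PU [x Ux]|_]; last exact: weight0_ge0.
by rewrite /weight0; case: asboolP => // Uk; rewrite Uk in Ux.
Qed.

End CoverOuterBounds.

Section LebesgueBounds.
Context {R : realType} {n : nat}.
Local Open Scope ereal_scope.

(** The weight of a set is an infimum of volumes: boxes that nearly realise these
    infima, with a total excess of at most half the volume [V], cover the box. *)
Lemma lebesgue_outer_box_gt0 (a b : 'rV[R]_n) :
  (forall j, a ord0 j < b ord0 j)%R -> 0 < lebesgue_outer (cbox a b).
Proof.
move=> ab; pose V : R := (\prod_(j < n) (b ord0 j - a ord0 j))%R.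
have V0 : (0 < V)%R by apply: prodr_gt0 => j _; rewrite subr_gt0.
have V20 : (0 < V / 2)%R by rewrite divr_gt0.
apply: (@lt_le_trans _ _ (V / 2)%:E); first by rewrite lte_fin.
apply: cover_outer_ge; first exact: box_volume_ge0.
move=> U boxU finU.
pose P k := `[< U k !=set0 >].
pose e k : R := (V / 2 / (2 ^ k.+1)%:R)%R.
have e0 k : (0 < e k)%R by rewrite divr_gt0// ltr0n expn_gt0.
pose ok k (ab : 'rV[R]_n * 'rV[R]_n) : Prop := P k ->
  [/\ forall j, (ab.1 ord0 j <= ab.2 ord0 j)%R, U k `<=` cbox ab.1 ab.2 &
      ((\prod_(j < n) (ab.2 ord0 j - ab.1 ord0 j))%:E <=
       box_volume (U k) + (e k)%:E)%E].
have [F FP] : {F & forall k, ok k (F k)}.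
  apply: (@choice _ _ ok) => k; rewrite /ok /P.
  case: (asboolP (U k !=set0)) => [Uk|nUk]; last first.
    by exists (a, b).
  have fin : box_volume (U k) \is a fin_num.
    by rewrite ge0_fin_numE ?box_volume_ge0 ?finU.
  have [_ [[A B] [/= AB UAB] <-] lte] := lb_ereal_inf_adherent (e0 k) fin.
  by exists (A, B) => _; split => //; exact: ltW.
have := @box_cover_rV R n a b P (fun k => (F k).1) (fun k => (F k).2).
rewrite -/V => H.
have {H} VP : V%:E <= \sum_(k <oo | P k)
    (\prod_(j < n) ((F k).2 ord0 j - (F k).1 ord0 j))%:E.
  apply: H => [j|k j /FP[]//|x /boxU[k _ Ukx]]; first exact: ltW.
  have Pk : P k by apply/asboolP; exists x.
  by exists k => //; have [_ sub _] := FP k Pk; exact: sub.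
have {}VP : V%:E <= \sum_(k <oo) weight0 (@box_volume R n) (U k) + (V / 2)%:E.
  apply: le_trans VP _.
  apply: (@le_trans _ _ (\sum_(k <oo | P k) (box_volume (U k) + (e k)%:E))).
    apply: lee_nneseries => [k _ Pk|k /FP[]//].
    have [ab' _ _] := FP k Pk.
    by rewrite lee_fin prodr_ge0// => j _; rewrite subr_ge0.
  apply: le_trans (epsilon_trick _ _ _) _.
  - by move=> k; exact: box_volume_ge0.
  - exact: ltW.
  rewrite leeD2r//; apply: nneseries_weight0; first exact: box_volume_ge0.
  by move=> k /asboolP.
move: VP; rewrite {1}(splitr V) EFinD leeD2rE//.
Qed.

Lemma lebesgue_outer_bounded (A : set 'rV[R]_n) :
  bounded_set A -> lebesgue_outer A < +oo.
Proof.
move=> [M [_ AM]].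
pose r : R := (`|M| + 1)%R.
have Ar : A `<=` cbox (const_mx (- r)%R) (const_mx r).
  move=> x Ax j; rewrite !mxE -ler_norml.
  have Mr : (M < r)%R by rewrite (le_lt_trans (ler_norm M))// ltrDl.
  have := AM _ Mr _ Ax; apply: le_trans.
  by rewrite [leRHS]mx_normrE; exact: (le_bigmax _ (fun i => `|x i.1 i.2|%R) (ord0, j)).
apply: le_lt_trans (cover_outer_le_weight _ _) _; first exact: box_volume_ge0.
rewrite /weight0; case: asboolP => // _.
apply: (@le_lt_trans _ _ (\prod_(j < n)
    ((const_mx r : 'rV[R]_n) ord0 j - (const_mx (- r)%R : 'rV[R]_n) ord0 j))%:E).
  apply: ereal_inf_lbound; exists (const_mx (- r)%R, const_mx r) => //=.
  split => // j; rewrite !mxE.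
  have : (0 <= r)%R by rewrite addr_ge0.
  by move=> r0; rewrite (le_trans _ r0)// oppr_le0.
exact: ltry.
Qed.

End LebesgueBounds.

(** * Two-sided bounds for Hausdorff measure *)

Section HausdorffBounds.
Context {R : realType} {n : nat} (s : nat).
Local Open Scope ereal_scope.

Lemma ball_volume_gt0 k : (0 < ball_volume R k)%R.
Proof.
suff: (0 < ball_volume R k)%R /\ (0 < ball_volume R k.+1)%R by case.
elim: k => [|k [IH1 IH2]]; first by rewrite /= ltr01 ltr0n.
by split=> //=; rewrite !mulr_gt0// ?invr_gt0// pi_gt0.
Qed.

(** A set of diameter [d] pulls back into a cube of side [2 c d], so a cover of
    [S] gives a cover of the unit cube by boxes. *)
Lemma hausdorff_outer_gt0 (S : set 'rV[R]_n) (psi : 'rV[R]_s -> 'rV[R]_n) (c : R) :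
  (0 < c)%R ->
  let Q := cbox (0 : 'rV[R]_s) (const_mx 1%R) in
  (forall x, Q x -> S (psi x)) ->
  (forall x y j, Q x -> Q y ->
    (`|x ord0 j - y ord0 j| <= c * enorm (psi x - psi y))%R) ->
  0 < @hausdorff_outer R n s S.
Proof.
move=> c0 Q QS psic; pose K : R := (ball_volume R s / 2 ^+ s)%R.
have K0 : (0 < K)%R by rewrite divr_gt0 ?ball_volume_gt0 ?exprn_gt0.
have k0 : (0 < (2 * c) ^+ s)%R by rewrite exprn_gt0// mulr_gt0.
apply: (@lt_le_trans _ _ (K / (2 * c) ^+ s)%:E).
  by rewrite lte_fin divr_gt0.
apply: le_trans (cover_le_hausdorff s S ltr01).
have hw0 : forall W : set 'rV[R]_n, 0 <= hausdorff_weight s 1 W.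
  exact: hausdorff_weight_ge0.
apply: cover_outer_ge => // U SU finU.
pose P k := `[< exists2 x, Q x & U k (psi x) >].
(* Only the sets that meet the image of the cube matter; [z k] is a point of the
   cube that is sent to the k-th one. *)
pose z k : 'rV[R]_s := if pselect (exists2 x, Q x & U k (psi x)) is left h
  then sval (cid2 h) else 0%R.
have zP k : P k -> Q (z k) /\ U k (psi (z k)).
  rewrite /P /z => /asboolP h; case: pselect => // h'.
  by split; case: (cid2 h').
have dP k : P k -> [/\ U k !=set0, diam (U k) \is a fin_num &
    hausdorff_weight s 1 (U k) = K%:E * diam (U k) ^+ s].
  move=> Pk; have [_ Uz] := zP k Pk.
  have U0 : U k !=set0 by exists (psi (z k)).
  have := finU k U0; rewrite /hausdorff_weight; case: asboolP => // -[_ d1] _.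
  split => //; rewrite ge0_fin_numE ?diam_ge0//.
  exact: le_lt_trans d1 (ltry _).

pose d k : R := fine (diam (U k)).
have d0 k : P k -> (0 <= d k)%R.
  by move=> /dP[U0 _ _]; exact/fine_ge0/diam_ge0.
have cover1 : 1%:E <= \sum_(k <oo | P k)
    (\prod_(j < s) (2 * c * d k))%:E.
  pose A k : 'rV[R]_s := (z k - const_mx (c * d k))%R.
  pose B k : 'rV[R]_s := (z k + const_mx (c * d k))%R.
  have := @box_cover_rV R s 0%R (const_mx 1%R) P A B.
  rewrite big1 => [|j _]; last by rewrite !mxE subr0.
  move=> /(_ _ _ _)/le_trans; apply.
  - by move=> j; rewrite !mxE.
  - move=> k j Pk; rewrite !mxE.
    by rewrite lerD2l ge0_cp// mulr_ge0 ?d0// ltW.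
  - move=> x Qx; have [k _ Ux] := SU _ (QS x Qx).
    have Pk : P k by apply/asboolP; exists x.
    exists k => // j; have [Qz Uz] := zP k Pk; have [_ fd _] := dP k Pk.
    rewrite !mxE.
    have : (`|x ord0 j - z k ord0 j| <= c * d k)%R.
      apply: le_trans (psic _ _ _ Qx Qz) _; rewrite ler_pM2l//.
      by rewrite -lee_fin fineK//; exact: enorm_le_diam.
    by rewrite ler_norml => /andP[h1 h2]; apply/andP; split; lra.
  apply: lee_nneseries => [k _ Pk|k Pk].
    rewrite lee_fin prodr_ge0// => j _; rewrite !mxE.
    have := mulr_ge0 (ltW c0) (d0 k Pk); lra.
  rewrite lee_fin; apply: ler_prod => j _; rewrite !mxE.
  have := mulr_ge0 (ltW c0) (d0 k Pk) => h; apply/andP; split; lra.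
have Kc0 : (0 <= K / (2 * c) ^+ s)%R by rewrite divr_ge0 ?ltW.
rewrite -[leLHS]mule1.
apply: le_trans (lee_wpmul2l _ cover1) _; first by rewrite lee_fin.
rewrite -nneseriesZl; last first.
  move=> k Pk; rewrite lee_fin prodr_ge0// => j _.
  by rewrite !mulr_ge0 ?d0// ltW.
apply: le_trans _ (nneseries_weight0 (tau := hausdorff_weight s 1) hw0 (P := P) _).
  apply: lee_nneseries => [k _ Pk|k Pk].
    rewrite mule_ge0 ?lee_fin// prodr_ge0// => j _.
    by rewrite !mulr_ge0 ?d0// ltW.
  have [_ fd ->] := dP k Pk.
  rewrite prodr_const card_ord -[diam (U k)]fineK// -EFin_expe -!EFinM lee_fin.
  by rewrite (exprMn s (2 * c)%R) mulrA divfK ?gt_eqF.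
by move=> k /dP[].
Qed.

(** The pieces of the image over the [N ^ s] cells of a grid of the unit cube have
    diameter at most [C / N], so the sum of their weights is bounded independently
    of [N]. *)
Lemma hausdorff_outer_lty (Y : Type) (f : set Y) (p : Y -> 'I_s -> R)
    (psi : Y -> 'rV[R]_n) (C : R) :
  (forall y j, f y -> (0 <= p y j <= 1)%R) ->
  (forall y y' e, f y -> f y' -> (forall j, (`|p y j - p y' j| <= e)%R) ->
    (0 <= e)%R -> (enorm (psi y - psi y') <= C * e)%R) ->
  @hausdorff_outer R n s (psi @` f) < +oo.
Proof.
move=> p01 psiC; pose K : R := (ball_volume R s / 2 ^+ s)%R.
have K0 : (0 <= K)%R by rewrite divr_ge0 ?ball_volume_ge0 ?exprn_ge0.
pose C' : R := Num.max C 1%R.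
have C'1 : (0 < C')%R by rewrite lt_max ltr01 orbT.
apply: (@le_lt_trans _ _ (K * C' ^+ s)%:E); last exact: ltry.
apply: ge_ereal_sup => _ [delta /= delta0 <-].
(* Fine enough for the pieces to have diameter at most [delta]. *)
pose N := (Num.truncn (C' / delta)).+1.
have N0 : (0 < N%:R :> R)%R by rewrite ltr0n.
have Nd : (C' / N%:R <= delta)%R.
  by rewrite ler_pdivrMr// -ler_pdivrMl// mulrC; exact/ltW/truncnS_gt.
pose I : finType := {ffun 'I_s -> 'I_N}.
pose V (i : I) : set 'rV[R]_n := psi @` (f `&`
  [set y | forall j, (i j)%:R / N%:R <= p y j <= (i j).+1%:R / N%:R]%R).
have hw0 : forall W : set 'rV[R]_n, 0 <= hausdorff_weight s delta W.
  exact: hausdorff_weight_ge0.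
have V_weight i : weight0 (hausdorff_weight s delta) (V i) <=
    (K * (C' / N%:R) ^+ s)%:E.
  rewrite /weight0; case: asboolP => [_|/eqP/set0P V0].
    by rewrite lee_fin mulr_ge0// exprn_ge0// divr_ge0// ltW.
  have dV : diam (V i) <= (C' / N%:R)%:E.
    apply: ge_ereal_sup => _ [[_ _] /= [[y [fy yi] <-] [y' [fy' yi'] <-]] <-].
    rewrite lee_fin; apply: le_trans (psiC y y' (N%:R^-1)%R fy fy' _ _) _.
    - move=> j; have /andP[h1 h2] := yi j; have /andP[h3 h4] := yi' j.
      rewrite -natr1 mulrDl div1r in h2; rewrite -natr1 mulrDl div1r in h4.
      by rewrite ler_norml; apply/andP; split; lra.
    - by rewrite invr_ge0 ltW.
    - by rewrite ler_wpM2r ?invr_ge0 ?(ltW N0)// le_max lexx.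
  rewrite /hausdorff_weight; case: asboolP => [_|[]]; last first.
    by split => //; apply: le_trans dV _; rewrite lee_fin.
  rewrite (EFinM K) EFin_expe lee_wpmul2l ?lee_fin//.
  by apply: lee_pX => //; exact: diam_ge0.
apply: (@le_trans _ _ (\sum_(W <- [seq V i | i <- enum I])
    weight0 (hausdorff_weight s delta) W)).
  apply: cover_outer_le_seq => // _ [y fy <-].
  (* The points with a coordinate equal to 1 go to the last cells. *)
  pose g (j : 'I_s) : 'I_N := inord (minn (Num.truncn (p y j * N%:R)) N.-1).
  exists (enum_rank [ffun j => g j]) => //.
  rewrite (nth_map [ffun j => g j]) -?cardE ?ltn_ord// -/(enum_val _).
  rewrite nth_enum_rank.
  exists y => //; split => // j; rewrite ffunE /g inordK; last first.
    by rewrite ltnS geq_minr.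
  have /andP[p0 p1] := p01 y j fy.
  have pN0 : (0 <= p y j * N%:R)%R by rewrite mulr_ge0// ltW.
  have /andP[t1 t2] := truncn_itv pN0.
  rewrite ler_pdivrMr// ler_pdivlMr//.
  case: (leqP (Num.truncn (p y j * N%:R)) N.-1) => h.
    by rewrite t1/= ltW.
  apply/andP; split; first by apply: le_trans t1; rewrite ler_nat ltnW.
  by rewrite ler_piMl// ltW.
rewrite big_map.
apply: (@le_trans _ _ (\sum_(i <- enum I) (K * (C' / N%:R) ^+ s)%:E)).
  by apply: lee_sum => i _.
rewrite sumEFin lee_fin big_const_seq count_predT -cardE card_ffun !card_ord.
rewrite iter_addr_0 -[leLHS]mulr_natl natrX mulrCA -exprMn mulrCA divff ?mulr1//.
by rewrite gt_eqF.
Qed.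

End HausdorffBounds.

(** * Reference cells and their facets *)

Section Reference.
Context {R : realType} {nu m : nat}.
Implicit Types (K : cell nu m) (xi eta : 'rV[R]_nu) (f : set 'rV[R]_nu).

Lemma barycentric_lift j xi : barycentric (lift ord0 j) xi = xi ord0 j.
Proof. by rewrite /barycentric liftK. Qed.

Lemma barycentric0 xi : barycentric ord0 xi = 1 - \sum_(j < nu) xi ord0 j.
Proof. by rewrite /barycentric unlift_none. Qed.

Lemma barycentric_segment a t xi eta :
  barycentric a ((1 - t) *: xi + t *: eta) =
  (1 - t) * barycentric a xi + t * barycentric a eta.
Proof.
case: (unliftP ord0 a) => [j|] ->; first by rewrite !barycentric_lift !mxE.
rewrite !barycentric0.
under eq_bigr do rewrite !mxE.
rewrite big_split/= -!mulr_sumr; ring.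
Qed.

Lemma ref_cell01 K xi : ref_cell K xi -> forall j, 0 <= xi ord0 j <= 1.
Proof.
case: K => g //= xi0 j.
have pos i : 0 <= xi ord0 i by rewrite -barycentric_lift.
rewrite pos/=; have := xi0 ord0; rewrite barycentric0 subr_ge0; apply: le_trans.
by rewrite (bigD1 j)//= lerDl; apply: sumr_ge0.
Qed.

Lemma ref_facets_sub K f : ref_facets K f -> f `<=` ref_cell K.
Proof. by case: K => g /= [? _ <-] x []. Qed.

Lemma ref_facets_segment K f t xi eta : ref_facets K f -> 0 <= t <= 1 ->
  f xi -> f eta -> f ((1 - t) *: xi + t *: eta).
Proof.
move=> Kf /andP[t0 t1]; have t1' : 0 <= 1 - t by rewrite subr_ge0.
case: K Kf => g /= [a _ <-] /= [xi0 xia] [eta0 etaa]; split.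
- by move=> b; rewrite barycentric_segment addr_ge0// mulr_ge0.
- by rewrite barycentric_segment xia etaa !mulr0 addr0.
- move=> j; rewrite !mxE.
  have /andP[x0 x1] := xi0 j; have /andP[y0 y1] := eta0 j.
  rewrite addr_ge0 ?mulr_ge0//=.
  apply: (@le_trans _ _ ((1 - t) * 1 + t * 1)); last by rewrite !mulr1 subrK.
  by apply: lerD; apply: ler_wpM2l.
- by rewrite !mxE xia etaa -mulrDl subrK mul1r.
Qed.

(** Telescoping: replace the factors one at a time. *)
Lemma prod_lipschitz (I : Type) (s : seq I) (F G : I -> R) :
  (forall i, 0 <= F i <= 1) -> (forall i, 0 <= G i <= 1) ->
  `|\prod_(i <- s) F i - \prod_(i <- s) G i| <= \sum_(i <- s) `|F i - G i|.
Proof.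
move=> F01 G01; elim: s => [|i s IH]; first by rewrite !big_nil subrr normr0.
rewrite !big_cons.
set f := \prod_(j <- s) F j in IH *; set g := \prod_(j <- s) G j in IH *.
have -> : F i * f - G i * g = (F i - G i) * f + G i * (f - g) by ring.
have f01 : 0 <= f <= 1.
  by rewrite prodr_ge0 ?Num.Theory.prodr_ile1// => j _; case/andP: (F01 j).
have /andP[Gi0 Gi1] := G01 i; have /andP[f0 f1] := f01.
apply: le_trans (ler_normD _ _) _; apply: lerD.
  by rewrite normrM (ger0_norm f0) ler_piMr.
by rewrite normrM (ger0_norm Gi0); apply: le_trans IH; rewrite ler_piMl.
Qed.

Lemma sum_lipschitz (I : finType) k (phi : I -> 'rV[R]_nu -> R)
    (w : I -> 'rV[R]_k) (D : set 'rV[R]_nu) :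
  (forall a xi eta e, D xi -> D eta -> 0 <= e ->
    (forall j, `|xi ord0 j - eta ord0 j| <= e) ->
    `|phi a xi - phi a eta| <= nu%:R * e) ->
  exists2 C, 0 <= C & forall xi eta e, D xi -> D eta -> 0 <= e ->
    (forall j, `|xi ord0 j - eta ord0 j| <= e) ->
    enorm (\sum_a phi a xi *: w a - \sum_a phi a eta *: w a) <= C * e.
Proof.
move=> philip; pose C := \sum_a \sum_j (nu%:R * `|w a ord0 j|).
have C0 : 0 <= C by apply: sumr_ge0 => a _; apply: sumr_ge0 => j _; rewrite mulr_ge0.
exists (k%:R * C); first by rewrite mulr_ge0.
move=> xi eta e Dxi Deta e0 xie; rewrite -mulrA; apply: enorm_le_coord.
  exact: mulr_ge0.
move=> j; rewrite -sumrB summxE mulr_suml.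
apply: le_trans (ler_norm_sum _ _ _) _; apply: ler_sum => a _.
rewrite -scalerBl mxE normrM.
apply: (@le_trans _ _ (nu%:R * e * `|w a ord0 j|)).
  by rewrite ler_wpM2r// philip.
rewrite mulr_suml (bigD1 j)//= mulrAC lerDl.
by apply: sumr_ge0 => i _; rewrite !mulr_ge0.
Qed.

Lemma interp_lipschitz k K (w : 'I_m -> 'rV[R]_k) :
  exists2 C, 0 <= C & forall xi eta e, ref_cell K xi -> ref_cell K eta ->
    0 <= e -> (forall j, `|xi ord0 j - eta ord0 j| <= e) ->
    enorm (interp K w xi - interp K w eta) <= C * e.
Proof.
have sum_e e : \sum_(j < nu) e = nu%:R * e :> R.
  by rewrite sumr_const card_ord mulr_natl.
case: K => g /=; apply: (sum_lipschitz (fun a => w (g a))).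
- move=> a xi eta e _ _ e0 xie; case: (unliftP ord0 a) => [j|] ->.
    rewrite !barycentric_lift (le_trans (xie j))//.
    by rewrite ler_peMl// ler1n; case: (nu) j => // -[].
  rewrite !barycentric0 opprD addrACA subrr add0r opprK addrC -sumrB -sum_e.
  apply: le_trans (ler_norm_sum _ _ _) _; apply: ler_sum => j _.
  by rewrite distrC.
- move=> b xi eta e xi01 eta01 e0 xie.
  have factor01 (z : 'rV[R]_nu) : (forall j, 0 <= z ord0 j <= 1) ->
      forall j, 0 <= (if b j then z ord0 j else 1 - z ord0 j) <= 1.
    move=> z01 j; have /andP[z0 z1] := z01 j; case: (b j); first exact: z01.
    by apply/andP; split; lra.
  apply: le_trans (prod_lipschitz _ (factor01 xi xi01) (factor01 eta eta01)) _.
  rewrite -sum_e; apply: ler_sum => j _; case: (b j) => //.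
  by rewrite opprB addrC addrA subrK distrC.
Qed.

Lemma interp_vertex (V : lmodType R) K (w : 'I_m -> V) r :
  is_vertex K r -> exists2 xi, ref_cell K xi & interp K w xi = w r.
Proof.
case: K => g /= [a <-].
- pose xi : 'rV[R]_nu := \row_j (a == lift ord0 j)%:R.
  have xiE b : barycentric b xi = (b == a)%:R.
    case: (unliftP ord0 b) => [j|] ->; first by rewrite barycentric_lift mxE eq_sym.
    rewrite barycentric0; under eq_bigr do rewrite mxE.
    case: (unliftP ord0 a) => [i|] ->.
      rewrite (bigD1 i)//= eqxx big1 ?addr0 ?subrr// => j ji.
      by rewrite (inj_eq lift_inj) eq_sym (negPf ji).
    by rewrite eqxx big1 ?subr0// => j _.
  exists xi; first by move=> b; rewrite xiE.
  rewrite (bigD1 a)//= xiE eqxx scale1r big1 ?addr0// => b /negPf ba.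
  by rewrite xiE ba scale0r.
- pose xi : 'rV[R]_nu := \row_j (a j)%:R.
  have xiE b : multilinear b xi = (b == a)%:R.
    rewrite /multilinear; have [->|ba] := eqVneq.
      by rewrite big1// => j _; rewrite mxE; case: (a j); rewrite ?subr0.
    have [j bj] : exists j, b j != a j.
      apply/existsP; rewrite -negb_forall; apply: contra ba => /forallP h.
      by apply/eqP/ffunP => j; exact/eqP.
    rewrite (bigD1 j)//= mxE.
    by case: (b j) (a j) bj => -[]//= _; rewrite ?subrr mul0r.
  exists xi => [j|]; first by rewrite mxE; case: (a j); rewrite ?ler01 ?lexx.
  rewrite (bigD1 a)//= xiE eqxx scale1r big1 ?addr0// => b /negPf ba.
  by rewrite xiE ba scale0r.
Qed.

End Reference.

Section Facets.
Context {R : realType} {n m : nat}.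
Implicit Types (K : cell n.+1 m) (f : set 'rV[R]_n.+1).

Let chart (j0 : 'I_n.+1) (e : 'rV[R]_n -> R) (x : 'rV[R]_n) : 'rV[R]_n.+1 :=
  \row_i if unlift j0 i is Some j then x ord0 j / n.+1%:R else e x.

Let chart_lift j0 e x j : chart j0 e x ord0 (lift j0 j) = x ord0 j / n.+1%:R.
Proof. by rewrite mxE liftK. Qed.

Let chart_none j0 e x : chart j0 e x ord0 j0 = e x.
Proof. by rewrite mxE unlift_none. Qed.

(** A facet lies on the graph of an affine function of all coordinates but the
    [j0]-th. The cube is shrunk by [n.+1] for its points to have coordinates of
    sum at most 1, as the simplex requires. *)
Lemma ref_facets_chart K f : ref_facets K f -> exists j0 : 'I_n.+1,
  (forall xi eta e, f xi -> f eta -> 0 <= e ->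
    (forall j, `|xi ord0 (lift j0 j) - eta ord0 (lift j0 j)| <= e) ->
    forall j, `|xi ord0 j - eta ord0 j| <= n.+1%:R * e) /\
  exists phi : 'rV[R]_n -> 'rV[R]_n.+1,
    (forall x j, phi x ord0 (lift j0 j) = x ord0 j / n.+1%:R) /\
    (forall x, cbox 0 (const_mx 1) x -> f (phi x)).
Proof.
have n0 : 0 < n.+1%:R :> R by rewrite ltr0n.
have e_le e : 0 <= e -> e <= n.+1%:R * e :> R.
  by move=> e0; rewrite ler_peMl// ler1n.
have cube (x : 'rV[R]_n) : cbox 0 (const_mx 1) x ->
    (forall j, 0 <= x ord0 j / n.+1%:R <= 1) /\
    0 <= \sum_(j < n) (x ord0 j / n.+1%:R) <= 1.
  move=> x01; have x0 j : 0 <= x ord0 j / n.+1%:R <= n.+1%:R^-1.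
    have := x01 j; rewrite !mxE => /andP[? ?].
    by rewrite divr_ge0//= ler_pdivrMr// mulVf// gt_eqF.
  have n1 : n.+1%:R^-1 <= 1 :> R by rewrite invf_le1// ler1n.
  split=> [j|].
    by have /andP[-> h] := x0 j; exact: le_trans h n1.
  rewrite sumr_ge0 => [|j _]; last by case/andP: (x0 j).
  apply: (@le_trans _ _ (\sum_(j < n) n.+1%:R^-1)).
    by apply: ler_sum => j _; case/andP: (x0 j).
  by rewrite sumr_const card_ord -[leLHS]mulr_natl ler_pdivrMr// mul1r ler_nat.
have lip_fixed j0 f' : (forall xi eta, f' xi -> f' eta -> xi ord0 j0 = eta ord0 j0) ->
    forall xi eta e, f' xi -> f' eta -> 0 <= e ->
    (forall j, `|xi ord0 (lift j0 j) - eta ord0 (lift j0 j)| <= e) ->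
    forall j, `|xi ord0 j - eta ord0 j| <= n.+1%:R * e.
  move=> fixed xi eta e fxi feta e0 xie j; apply: le_trans (e_le e e0).
  case: (unliftP j0 j) => [i|] ->; first exact: xie.
  by rewrite (fixed _ _ fxi feta) subrr normr0.
case: K => g /= [].
- move=> a _ <-; case: (unliftP ord0 a) => [j0|] ->.
  + exists j0; split.
      apply: lip_fixed => xi eta [_ /=].
      by rewrite barycentric_lift => -> [_ /=]; rewrite barycentric_lift => ->.
    exists (chart j0 (fun=> 0)); split => [x j|x /cube[x0 sx]].
      exact: chart_lift.
    split; last by rewrite /= barycentric_lift chart_none.
    move=> b; case: (unliftP ord0 b) => [i|] ->.
      rewrite barycentric_lift; case: (unliftP j0 i) => [j|] ->.
        by rewrite chart_lift; case/andP: (x0 j).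
      by rewrite chart_none.
    rewrite barycentric0 (bigD1_ord j0)//= chart_none add0r subr_ge0.
    by under eq_bigr do rewrite chart_lift; case/andP: sx.
  + exists ord0; split.
      move=> xi eta e [_ /= xi0] [_ /= eta0] e0 xie j.
      case: (unliftP ord0 j) => [i|] ->.
        by apply: le_trans (e_le e e0); exact: xie.
      move: xi0 eta0; rewrite !barycentric0 !(bigD1_ord ord0)//=.
      set s1 := \sum_(i < n) _; set s2 := \sum_(i < n) _ => h1 h2.
      have -> : xi ord0 ord0 - eta ord0 ord0 = s2 - s1 by lra.
      rewrite /s1 /s2 -sumrB; apply: le_trans (ler_norm_sum _ _ _) _.
      apply: (@le_trans _ _ (\sum_(i < n) e)).
        by apply: ler_sum => i _; rewrite distrC; exact: xie.
      by rewrite sumr_const card_ord -[leLHS]mulr_natl ler_wpM2r// ler_nat.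
    exists (chart ord0 (fun x => 1 - \sum_(j < n) (x ord0 j / n.+1%:R))).
    split => [x j|x /cube[x0 /andP[sx0 sx1]]]; first exact: chart_lift.
    have b0 : barycentric ord0
        (chart ord0 (fun x => 1 - \sum_(j < n) (x ord0 j / n.+1%:R)) x) = 0.
      rewrite barycentric0 (bigD1_ord ord0)//= chart_none.
      rewrite (eq_bigr _ (fun j _ => chart_lift ord0 _ x j)).
      by rewrite subrK subrr.
    split => // b; case: (unliftP ord0 b) => [i|] ->; last by rewrite b0.
    rewrite barycentric_lift; case: (unliftP ord0 i) => [j|] ->.
      by rewrite chart_lift; case/andP: (x0 j).
    by rewrite chart_none subr_ge0.
- move=> [j0 b] _ <-; exists j0; split.
    by apply: lip_fixed => xi eta [_ /= ->] [_ /= ->].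
  exists (chart j0 (fun=> b%:R)); split => [x j|x /cube[x0 _]].
    exact: chart_lift.
  split; last by rewrite /= chart_none.
  move=> /= i; case: (unliftP j0 i) => [j|] ->; first by rewrite chart_lift.
  by rewrite chart_none; case: (b); rewrite ?ler01 ?lexx.
Qed.

End Facets.

(** * Facets of a mesh and nodal Gram matrices *)

Lemma outer_measure_bigcup_lty (R : realType) (T : Type) (I : choiceType)
    (mu : {outer_measure set T -> \bar R}) (D : set I) (F : I -> set T) :
  finite_set D -> (forall i, D i -> (mu (F i) < +oo)%E) ->
  (mu (\bigcup_(i in D) F i) < +oo)%E.
Proof.
move=> /finite_seqP[s ->]; elim: s => [|i s IH] sF.
  by rewrite set_nil bigcup_set0 outer_measure0.
have -> : [set` i :: s] = i |` [set` s].
  by apply/seteqP; split => j /=; rewrite inE => /predU1P.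
rewrite bigcup_setU1.
apply: le_lt_trans (outer_measureU2 _ _ _) _; apply: lte_add_pinfty.
  by apply: sF; rewrite /= mem_head.
by apply: IH => j js; apply: sF; rewrite /= inE js orbT.
Qed.

Section MeshFacets.
Context {R : realType} {n : nat} (M : mesh R n.+1).

Lemma cell_facets_finite c : finite_set (@cell_facets R n.+1 M c).
Proof.
by apply: finite_image; case: (cells c) => g; apply: finite_image; exact: finite_finset.
Qed.

Lemma cell_facets_lty c F : @cell_facets R n.+1 M c F ->
  (@hausdorff_outer R n.+1 n F < +oo)%E.
Proof.
move=> [f Kf <-]; have [j0 [fcoord _]] := ref_facets_chart Kf.
have [C C0 lipC] := interp_lipschitz (cells c) (@node R n.+1 M).
apply: (@hausdorff_outer_lty R n.+1 n _ f (fun xi j => xi ord0 (lift j0 j))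
  (cell_map c) (C * n.+1%:R)).
  by move=> xi j fxi; exact: (ref_cell01 (ref_facets_sub Kf fxi)).
move=> xi eta e fxi feta xie e0; rewrite -mulrA; apply: lipC.
- exact: (ref_facets_sub Kf fxi).
- exact: (ref_facets_sub Kf feta).
- by rewrite mulr_ge0.
- exact: fcoord.
Qed.

(** The chart of the facet, contracted towards the preimage of [x], stays
    within the ball; the reference map is one-to-one with Lipschitz inverse. *)
Lemma cell_facets_gt0 c F x r : Defs.nondegenerate (m := M) c ->
  cell_facets c F -> F x -> 0 < r ->
  (0 < @hausdorff_outer R n.+1 n (F `&` ball x r))%E.
Proof.
move=> [kappa kappa0 nondeg] [f Kf <-] [xi0 fxi0 <-] r0.
have [j0 [_ [phi [phiE phif]]]] := ref_facets_chart Kf.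
have [C C0 lipC] := interp_lipschitz (cells c) (@node R n.+1 M).
have rC : 0 < r + C by rewrite ltr_wpDr.
(* The contraction ratio: at most 1, and such that [C * t < r]. *)
pose t := r / (r + C).
have t0 : 0 < t by rewrite divr_gt0.
have t1 : t <= 1 by rewrite ler_pdivrMr// mul1r lerDl.
have Ct : C * t < r.
  by rewrite /t mulrA ltr_pdivrMr// [ltRHS]mulrC ltr_pM2r// ltrDr.
pose q x := (1 - t) *: xi0 + t *: phi x.
have fq y : cbox 0 (const_mx 1) y -> f (q y).
  by move=> y01; apply: (ref_facets_segment Kf) => //; [rewrite (ltW t0)|exact: phif].
apply: (hausdorff_outer_gt0 (psi := fun y => cell_map c (q y))
  (c := n.+1%:R / t / kappa)).
- by rewrite !divr_gt0.
- move=> y y01; split; first by exists (q y) => //; exact: fq.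
  apply/ball_rV => // j.
  apply: le_lt_trans Ct.
  have := coord_le_enorm (cell_map c xi0 - cell_map c (q y)) j.
  rewrite !mxE => /le_trans; apply; apply: lipC.
  + exact: (ref_facets_sub Kf fxi0).
  + exact/(ref_facets_sub Kf)/fq.
  + exact: ltW.
  + move=> i; rewrite !mxE.
    have -> : xi0 ord0 i - ((1 - t) * xi0 ord0 i + t * phi y ord0 i) =
      t * (xi0 ord0 i - phi y ord0 i) by ring.
    rewrite normrM gtr0_norm// ler_piMr ?(ltW t0)//.
    have /andP[a0 a1] := ref_cell01 (ref_facets_sub Kf fxi0) i.
    have /andP[b0 b1] := ref_cell01 (ref_facets_sub Kf (phif _ y01)) i.
    by rewrite ler_norml; apply/andP; split; lra.
- move=> y z j y01 z01.
  have := nondeg (q y) (q z) (mem_set (ref_facets_sub Kf (fq _ y01)))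
    (mem_set (ref_facets_sub Kf (fq _ z01))).
  rewrite -ler_pdivlMl// => qyz.
  have := le_trans (coord_le_enorm _ (lift j0 j)) qyz.
  have -> : (q y - q z) ord0 (lift j0 j) =
      t / n.+1%:R * (y ord0 j - z ord0 j).
    by rewrite !mxE !phiE; ring.
  have tn : 0 < t / n.+1%:R by rewrite divr_gt0.
  rewrite normrM gtr0_norm// -ler_pdivlMl// => /le_trans; apply.
  by rewrite invf_div mulrA.
Qed.

Lemma interface_lty gamma : induces_partition M gamma ->
  (@hausdorff_outer R n.+1 n gamma < +oo)%E.
Proof.
move=> gammaE.
have sub : gamma `<=` \bigcup_(F in \bigcup_c cell_facets (m := M) c) F.
  move=> x /subset_closure; rewrite gammaE => -[F [[c cF] _] Fx].
  by exists F => //; exists c.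
apply: le_lt_trans (hausdorff_outer_le n sub) _.
apply: outer_measure_bigcup_lty.
  by apply: bigcup_finite => // c _; exact: cell_facets_finite.
by move=> F [c _ cF]; exact: cell_facets_lty cF.
Qed.

End MeshFacets.

(** Near a node where the coefficient of the combination is nonzero, its modulus
    stays above half of its value there. *)
Lemma nodal_gram_positive_definite (R : realType) nu
    (mu : {outer_measure set 'rV[R]_nu -> \bar R}) (C A : set 'rV[R]_nu) m
    (f : 'I_m -> 'rV[R]_nu -> R) (z : 'I_m -> 'rV[R]_nu) :
  separated_additive mu -> compact C -> A `<=` C ->
  measurable (A : set (caratheodory_type mu)) -> (mu A < +oo)%E ->
  (forall i, {within C, continuous (f i)}) -> (forall i, C (z i)) ->
  (forall i j, f i (z j) = (i == j)%:R) ->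
  (forall i V, open V -> V (z i) -> (0 < mu (A `&` V))%E) ->
  positive_definite (\matrix_(r, t)
    \int[caratheodory_measure mu]_(x in A) (f r x * f t x)).
Proof.
move=> sep cptC AC mA muA cf Cz fz pos.
apply: (gram_positive_definite (mu := caratheodory_measure mu)) => //.
  move=> i; split; first exact: continuous_caratheodory (cf i).
  have [M [_ fM]] := compact_bounded (continuous_compact (cf i) cptC).
  exists (`|M| + 1) => x Ax; apply: (fM (`|M| + 1)) => /=.
    by rewrite (le_lt_trans (ler_norm M))// ltrDl.
  by exists x => //; exact: AC.
move=> v /matrix0Pn[i [j]]; rewrite ord1 => vi0.
pose u x := \sum_l v l ord0 * f l x.
have uz : u (z i) = v i ord0.
  rewrite /u (bigD1 i)//= fz eqxx mulr1 big1 ?addr0// => l /negPf li.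
  by rewrite fz li mulr0.
have cu : {within C, continuous u}.
  rewrite /u => x; apply: cvg_big => [|l _]; first exact: add_continuous.
  by apply: cvgM; [exact: cvg_cst|exact: cf].
pose e := `|v i ord0| / 2.
have e0 : 0 < e by rewrite divr_gt0// normr_gt0.
have oe : open [set y : R | e < `|y|].
  have -> : [set y : R | e < `|y|] = Num.norm @^-1` [set y | e < y] by [].
  by apply: open_comp; [move=> *; exact: norm_continuous|exact: open_gt].
have /continuousP cu' := cu.
have [V oV VC] := (open_subspaceP _ _).1 (cu' _ oe).
have Vz : V (z i).
  suff : (V `&` C) (z i) by case.
  rewrite VC; split => //=; rewrite /from_subspace uz /e.
  by rewrite ltr_pdivrMr// ltr_pMr ?normr_gt0// ltr1n.
exists (A `&` V), e; split => //.
- by apply: measurableI => //; exact: open_caratheodory.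
- exact: (pos i V oV Vz).
- move=> x [Ax Vx]; apply: ltW.
  suff : (u @^-1` [set y | e < `|y|] `&` C) x by case.
  by rewrite -VC; split => //; exact: AC.
Qed.

(** * Mass and coupling matrices *)

Section Subdomain.
Context {R : realType} {nu : nat} (Omega gamma : set 'rV[R]_nu).
Variables (D : side -> fe_subdomain R nu).
Hypothesis geom : two_subdomains Omega gamma (fun i => dom (D i)).
Hypothesis fe : forall i, fe_partition (msh (D i)) (dom (D i)).
Hypothesis basis : forall i, nodal_basis (dom (D i)) (@basis_fun R nu (D i)).

Lemma subdomain_bounded i : bounded_set (dom (D i)).
Proof.
have [M [Mr OM]] := region_bounded geom; exists M; split => // N MN x Dx.
by apply: (OM N MN); exact: (subdomain_sub geom Dx).
Qed.

Lemma subdomain_closure_compact i : compact (closure (dom (D i))).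
Proof.
apply: bounded_closed_compact; last exact: closed_closure.
have [M [Mr OM]] := subdomain_bounded i; exists M; split => // N MN x.
have cN : closed [set y : 'rV[R]_nu | `|y| <= N].
  have -> : [set y : 'rV[R]_nu | `|y| <= N] =
      (fun y : 'rV[R]_nu => `|y|) @^-1` [set r : R | r <= N] by [].
  apply: preimage_closed; last exact: closed_le.
  by move=> y _; exact: norm_continuous.
by move=> /(closureS (OM N MN)) xN; exact: cN.
Qed.

Lemma node_in_closure i r : closure (dom (D i)) (@node R nu (msh (D i)) r).
Proof.
have [c /(interp_vertex (@node R nu (msh (D i))))[xi Kxi xir]] :=
  node_vertex (fe i) r.
by rewrite (cell_cover (fe i)); exists c => //; exists xi.
Qed.

Lemma interface_closure i : gamma `<=` closure (dom (D i)).
Proof. by move=> x /(interface_boundary geom i)[]. Qed.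

(** The union of the two subdomains is open. *)
Lemma interface_closed_in : closure gamma `&` Omega `<=` gamma.
Proof.
move=> x [gx Ox]; rewrite (interfaceE geom); split => // Dx.
have oD : open (dom (D side1) `|` dom (D side2)).
  by apply: openU; exact: (subdomain_open geom).
have [y []] := gx _ (open_nbhs_nbhs (conj oD Dx)).
by rewrite (interfaceE geom) => -[].
Qed.

Lemma lebesgue_open_gt0 (V : set 'rV[R]_nu) : open V -> V !=set0 ->
  (0 < lebesgue_outer V)%E.
Proof.
move=> oV [x Vx].
have /nbhs_ballP[e /= e0 eV] := open_nbhs_nbhs (conj oV Vx).
pose b : 'rV[R]_nu := const_mx (e / 2).
have e2 : 0 < e / 2 by rewrite divr_gt0.
apply: (@lt_le_trans _ _ (lebesgue_outer (cbox (x - b) (x + b)))).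
  by apply: lebesgue_outer_box_gt0 => j; rewrite !mxE; lra.
apply: cover_outer_le => y yb; apply: eV; apply/ball_rV => // j.
have := yb j; rewrite !mxE => /andP[h1 h2].
by rewrite ltr_norml; apply/andP; split; lra.
Qed.

Lemma lebesgue_gram_positive_definite i m
    (idx : 'I_m -> 'I_(num_nodes (msh (D i)))) : injective idx ->
  positive_definite (\matrix_(r, t)
    \int[@lebesgue_rV R nu]_(x in dom (D i))
      (basis_fun (idx r) x * basis_fun (idx t) x)).
Proof.
move=> idx_inj.
have sep := @lebesgue_outer_separated R nu.
apply: (@nodal_gram_positive_definite R nu _ (closure (dom (D i))) _ _
  (fun r => basis_fun (idx r)) (fun r => node (idx r))) => //.
- exact: subdomain_closure_compact.
- exact: subset_closure.
- by apply: (open_caratheodory sep); exact: (subdomain_open geom).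
- exact: lebesgue_outer_bounded (subdomain_bounded i).
- by move=> r; case: ((basis i).1 (idx r)).
- by move=> r; exact: node_in_closure.
- by move=> r t; rewrite (basis i).2 (inj_eq idx_inj).
- move=> r V oV Vr; apply: lebesgue_open_gt0.
    by apply: openI => //; exact: (subdomain_open geom).
  exact: (node_in_closure (open_nbhs_nbhs (conj oV Vr))).
Qed.

End Subdomain.

Section Interface.
Context {R : realType} {n : nat} (Omega gamma : set 'rV[R]_n.+1).
Variables (D : side -> fe_subdomain R n.+1).
Hypothesis geom : two_subdomains Omega gamma (fun i => dom (D i)).
Hypothesis fe : forall i, fe_partition (msh (D i)) (dom (D i)).
Hypothesis trace : forall i, induces_partition (msh (D i)) gamma.
Hypothesis basis : forall i, nodal_basis (dom (D i)) (@basis_fun R n.+1 (D i)).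

(** Near [x], a facet through [x] that lies in the closure of [gamma] stays in
    [Omega], hence in [gamma]. *)
Lemma interface_gt0 x V : gamma x -> open V -> V x ->
  (0 < @hausdorff_outer R n.+1 n (gamma `&` V))%E.
Proof.
move=> gx oV Vx.
have Ox : Omega x by move: gx; rewrite (interfaceE geom) => -[].
have oVO : open (V `&` Omega) by apply: openI => //; exact: region_open geom.
have /nbhs_ballP[e /= e0 eVO] := open_nbhs_nbhs (conj oVO (conj Vx Ox)).
have := subset_closure gx; rewrite (trace side1) => -[F [[c cF] Fg] Fx].
apply: lt_le_trans (cell_facets_gt0 (cell_nondegenerate (fe side1) c) cF Fx e0) _.
apply: hausdorff_outer_le => y [Fy /eVO[Vy Oy]]; split => //.
by apply: (interface_closed_in geom); split => //; exact: Fg.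
Qed.

Lemma coupling_positive_definite i :
  positive_definite (coupling gamma (D i) (D i)).
Proof.
have sep := @hausdorff_outer_separated R n.+1 n.
pose idx : 'I_#|nodes gamma Interface (D i)| -> _ := enum_val.
have idx_gamma r : gamma (node (idx r)).
  by have := enum_valP r; rewrite inE => /andP[/asboolP].
apply: (@nodal_gram_positive_definite R n.+1 _ (closure (dom (D i))) _ _
  (fun r => basis_fun (idx r)) (fun r => node (idx r))) => //.
- exact: (subdomain_closure_compact geom).
- exact: (interface_closure geom).
- rewrite (interfaceE geom); apply: measurableD.
    by apply: (open_caratheodory sep); exact: region_open geom.
  apply: (open_caratheodory sep).
  by apply: openU; exact: (subdomain_open geom).
- exact: interface_lty (trace i).
- by move=> r; case: ((basis i).1 (idx r)).
- by move=> r; exact: (node_in_closure fe).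
- by move=> r t; rewrite (basis i).2 (inj_eq enum_val_inj).
- by move=> r V oV Vr; exact: interface_gt0 (idx_gamma r) oV Vr.
Qed.

End Interface.

Section ReducedMass.
Context {R : realType} {nu : nat} (gamma : set 'rV[R]_nu).
Variables (D : side -> fe_subdomain R nu) (d : side -> node_kind -> nat).
Variable Phi : forall i p, 'M[R]_(#|nodes gamma p (D i)|, d i p).

Definition free_node E
    (r : 'I_(#|nodes gamma Interface E| + #|nodes gamma Interior E|)) :
    'I_(num_nodes (msh E)) :=
  match fintype.split r with
  | inl a => enum_val a
  | inr b => enum_val b
  end.

Lemma free_node_inj E : injective (@free_node E).
Proof.
have disj (a : 'I_#|nodes gamma Interface E|) (b : 'I_#|nodes gamma Interior E|) :
    enum_val a <> enum_val b.
  move=> ab; have : enum_val a \in interior_nodes gamma E.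
    by rewrite ab; exact: (enum_valP b).
  rewrite finset.in_setC finset.in_setU negb_or => /andP[_].
  by rewrite (enum_valP a : enum_val a \in interface_nodes gamma E).
move=> r t; rewrite /free_node -[r]splitK -[t]splitK.
case: (fintype.split r) => a; case: (fintype.split t) => b; rewrite !unsplitK.
- by move=> /enum_val_inj ->.
- by move=> /disj.
- by move=> /esym/disj.
- by move=> /enum_val_inj ->.
Qed.

Definition full_mass E :
    'M[R]_(#|nodes gamma Interface E| + #|nodes gamma Interior E|) :=
  \matrix_(r, t) \int[@lebesgue_rV R nu]_(x in dom E)
    (basis_fun (free_node r) x * basis_fun (free_node t) x).

Lemma full_massE E : full_mass E =
  block_mx (mass gamma E Interface Interface) (mass gamma E Interface Interior)
           (mass gamma E Interior Interface) (mass gamma E Interior Interior).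
Proof.
apply/matrixP => r t; rewrite -[r]splitK -[t]splitK.
case: (fintype.split r) => a; case: (fintype.split t) => b /=;
  rewrite ?(block_mxEul, block_mxEur, block_mxEdl, block_mxEdr) !mxE /free_node;
  by rewrite -?[lshift _ a]/(unsplit (inl a)) -?[rshift _ a]/(unsplit (inr a))
    -?[lshift _ b]/(unsplit (inl b)) -?[rshift _ b]/(unsplit (inr b)) !unsplitK.
Qed.

Definition composite_basis i :
    'M[R]_(#|nodes gamma Interface (D i)| + #|nodes gamma Interior (D i)|,
           d i Interface + d i Interior) :=
  block_mx (Phi i Interface) 0 0 (Phi i Interior).

Lemma reduced_massE i : reduced_mass Phi i =
  (composite_basis i)^T *m full_mass (D i) *m composite_basis i.
Proof.
rewrite full_massE /composite_basis tr_block_mx !trmx0 !mulmx_block.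
by rewrite !(mul0mx, mulmx0, addr0, add0r).
Qed.

Lemma composite_basis_inj i :
  (forall p, (Phi i p)^T *m Phi i p = 1%:M) ->
  forall v : 'cV_(d i Interface + d i Interior),
    composite_basis i *m v = 0 -> v = 0.
Proof.
move=> PhiPhi; apply: orthonormal_inj.
rewrite /composite_basis tr_block_mx !trmx0 mulmx_block !PhiPhi.
by rewrite !(mul0mx, mulmx0, addr0, add0r) -scalar_mx_block.
Qed.

Lemma reduced_mass_symmetric i : symmetric_mx (reduced_mass Phi i).
Proof.
rewrite reduced_massE -[X in _ *m X]trmxK; apply: symmetric_congruence.
exact: gram_symmetric.
Qed.

End ReducedMass.

Theorem mainTheorem3 (R : realType) (nu : nat)
    (Omega gamma : set 'rV[R]_nu) (D : side -> fe_subdomain R nu)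
    (h sigma : side -> R)
    (s : side -> node_kind -> nat) (d : side -> node_kind -> nat)
    (X : forall i p, 'M[R]_(#|nodes gamma p (D i)|, s i p))
    (Phi : forall i p, 'M[R]_(#|nodes gamma p (D i)|, d i p))
    (k : side) :
  nu = 2%N \/ nu = 3%N ->
  two_subdomains Omega gamma (fun i => dom (D i)) ->
  (forall i, fe_partition (msh (D i)) (dom (D i))) ->
  (forall i, 0 < h i /\ 0 < sigma i) ->
  (forall i, quasi_uniform (msh (D i)) (h i) (sigma i)) ->
  (forall i, induces_partition (msh (D i)) gamma) ->
  (forall i, nodal_basis (dom (D i)) (@basis_fun R nu (D i))) ->
  (forall i p, (0 < d i p <= #|nodes gamma p (D i)|)%N) ->
  (forall i p, pod_basis (X i p) (Phi i p)) ->
  [/\ forall i, reduced_mass Phi i \in unitmx,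
      symmetric_mx (schur_complement k Phi),
      positive_definite (schur_complement k Phi) &
      schur_complement k Phi \in unitmx].
Proof.
move=> nu23 geom fe _ _ trace basis dn pod.
have [n nuE] : exists n, nu = n.+1 by case: nu23 => ->; [exists 1%N|exists 2%N].
subst nu.
have orth i p : (Phi i p)^T *m Phi i p = 1%:M.
  by have /andP[_ le] := dn i p; exact: pod_basis_orthonormal le (pod i p).
have Msym i := reduced_mass_symmetric Phi i.
have Mpd i : positive_definite (reduced_mass Phi i).
  rewrite reduced_massE; apply: positive_definite_congruence.
    exact: composite_basis_inj.
  apply: (lebesgue_gram_positive_definite geom fe basis).
  exact: free_node_inj.
have Ginj (v : 'cV_(d k Interface)) :
    (reduced_coupling k Phi k)^T *m v = 0 -> v = 0.
  apply: row_mx0_tr_inj => {v} v Gv.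
  have Gpd : positive_definite
      ((Phi k Interface)^T *m coupling gamma (D k) (D k) *m Phi k Interface).
    apply: positive_definite_congruence; first exact: orthonormal_inj.
    exact: coupling_positive_definite geom fe trace basis k.
  have := positive_definite_unit Gpd; rewrite -unitmx_tr => Gu.
  by rewrite -(mulKmx Gu v) Gv mulmx0.
have Spd : positive_definite (schur_complement k Phi).
  rewrite /schur_complement; case: k Ginj => Ginj.
    exact: schur_sum.
  by rewrite addrC; exact: schur_sum.
split => //.
- by move=> i; exact: positive_definite_unit.
- rewrite /schur_complement /symmetric_mx linearD /=.
  by congr (_ + _); apply: symmetric_congruence; exact: symmetric_inv.
- exact: positive_definite_unit.
Qed.
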